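(* Let $n\ge1$ and $u\in\mathfrak{S}_n$. The normal fan of the Bruhat interval polytope $\mathsf{Q}_{u_{\mathsf{h}},\,u_{\mathsf{h}}s(1,n)}$ is the fan $\Sigma_{\psi(u)}$ associated with the triangulation $\psi(u)$ of the convex $(n+2)$-gon $\mathsf{P}_{n+2}$.
   Context: Triangulations. Let $\mathsf{P}_{n+2}$ be a convex $(n+2)$-gon with vertices labelled $0,1,\dots,n+1$ in counterclockwise order. A triangulation $T$ of $\mathsf{P}_{n+2}$ is a decomposition into $n$ triangles by $n-1$ diagonals not crossing in their interiors; $T$ is also regarded as the set of all edges of these triangles (sides and chosen diagonals). Put $e=\{0,n+1\}$, the distinguished edge. Left and right trees. Define $F\colon T\setminus\{e\}\to\{\mathsf{L},\mathsf{R}\}$ recursively: for a triangulated polygon with distinguished edge $g$ (starting with $\mathsf{P}_{n+2}$ and $g=e$), the unique triangle containing $g$ has two other edges $f_{\mathsf{L}}(g),f_{\mathsf{R}}(g)$, named so that $f_{\mathsf{L}}(g),f_{\mathsf{R}}(g),g$ are placed counterclockwise; set $F(f_{\mathsf{L}}(g))=\mathsf{L}$, $F(f_{\mathsf{R}}(g))=\mathsf{R}$. Removing $g$ leaves two triangulated polygons (possibly single edges) with one common vertex and with distinguished edges $f_{\mathsf{L}}(g)$ and $f_{\mathsf{R}}(g)$; repeat for each of them that is not a single edge. The left tree $\mathcal{T}_T^{\mathsf{L}}$ has vertex set $\{0,\dots,n\}$, root $0$ and edge set $F^{-1}(\mathsf{L})$; the right tree $\mathcal{T}_T^{\mathsf{R}}$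 has vertex set $\{1,\dots,n+1\}$, root $n+1$ and edge set $F^{-1}(\mathsf{R})$. For each $1\le k\le n$ there is exactly one edge $\{k_{\mathsf{L}},k\}$ of $\mathcal{T}_T^{\mathsf{L}}$ with $k_{\mathsf{L}}<k$ and exactly one edge $\{k,k_{\mathsf{R}}\}$ of $\mathcal{T}_T^{\mathsf{R}}$ with $k<k_{\mathsf{R}}$; this defines $k_{\mathsf{L}},k_{\mathsf{R}}$. Fan. Let $M=\{x\in\mathbb{Z}^{n+1}\mid \sum x_i=0\}$ and $N=\mathbb{Z}^{n+1}/\mathbb{Z}(1,\dots,1)$, dual to $M$ via the dot product. Let $\varpi_i\in N$ be the image of $\sum_{k=1}^i e_k$ ($0\le i\le n+1$), so $\varpi_0=\varpi_{n+1}=0$. Put $\mathbf{v}_k=\varpi_k-\varpi_{k_{\mathsf{R}}}$ and $\mathbf{w}_k=\varpi_{k_{\mathsf{L}}}-\varpi_k$ for $k\in[n]=\{1,\dots,n\}$. $\Sigma_T$ is the complete non-singular fan in $N\otimes\mathbb{R}$ consisting of the cones $\operatorname{Cone}(Q)$ for subsets $Q\subset\{\mathbf{v}_k,\mathbf{w}_k\mid k\in[n]\}$ with $\{\mathbf{v}_i,\mathbf{w}_i\}\not\subset Q$ for all $i\in[n]$. The map $\psi$. A binary tree is either empty or has a root, a left subtree and a right subtree, both binary trees. For a triangulation $T$, the binary tree $\mathcal{B}_T$ has the triangles of $T$ as vertices, the triangle containing $e$ as root, and the left (right) child of a triangle with distinguished edge $g$ is the other triangle containing $f_{\mathsf{L}}(g)$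 (respectively $f_{\mathsf{R}}(g)$), if any. The map $T\mapsto\mathcal{B}_T$ is a bijection from triangulations of $\mathsf{P}_{n+2}$ to binary trees with $n$ vertices, and we identify the two sets through it. For $u\in\mathfrak{S}_n$ in one-line notation $u(1)\cdots u(n)$, the binary tree $\psi(u)$ is defined recursively: if $u(p)$ is the smallest entry of the sequence, it gives the root, the left subtree is the tree obtained in the same way from $u(1)\cdots u(p-1)$, and the right subtree is obtained in the same way from $u(p+1)\cdots u(n)$ (an empty sequence gives the empty tree). Bruhat interval polytopes. $s_i\in\mathfrak{S}_{n+1}$ is the transposition of $i,i+1$, and $s(1,n)=s_1s_2\cdots s_n$; products of permutations are compositions of maps, so $(us(1,n))(i)=u(i+1)$ for $i\le n$ and $(us(1,n))(n+1)=u(1)$ for $u\in\mathfrak{S}_{n+1}$. For $u\in\mathfrak{S}_n$, $u_{\mathsf{h}}\in\mathfrak{S}_{n+1}$ is given by $u_{\mathsf{h}}(1)=1$ and $u_{\mathsf{h}}(i)=u(i-1)+1$ for $2\le i\le n+1$. For $v\le w$ in the Bruhat order on $\mathfrak{S}_{n+1}$, $\mathsf{Q}_{v,w}$ is the convex hull in $\mathbb{R}^{n+1}$ of the points $(z(1),\dots,z(n+1))$ with $v\le z\le w$. Normal fan. The normal fan is taken with inward normals: it is the collection of cones $\sigma_E=\{x\in N\otimes\mathbb{R}\mid \langle x,y-p\rangle\ge0 \text{ for all } y\in\mathsf{Q}_{v,w},\ p\in E\}$ for nonempty faces $E$ of $\mathsf{Q}_{v,w}$ (the polytope lies in a hyperplane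 where the sum of coordinates is constant, so $y-p\in M\otimes\mathbb{R}$). *)

(* Defs.v *)
From HB Require Import structures.
From mathcomp Require Import boolp classical_sets reals convex.
From mathcomp Require Import all_boot all_order all_algebra all_fingroup.
From mathcomp Require Import zify.

Set Implicit Arguments.
Unset Strict Implicit.
Unset Printing Implicit Defensive.

Import Order.TTheory GRing.Theory Num.Theory.

(* The segment {a, b} is encoded by the ordered pair (a, b) with a < b. *)
Definition edge (n : nat) : Type := ('I_n.+2 * 'I_n.+2)%type.

Definition base_edge n : edge n := (ord0, ord_max).

Definition is_side n (g : edge n) : bool :=
  (g.2 == g.1.+1 :> nat) || (g == base_edge n).

Definition crossing n (g h : edge n) : bool :=
  [&& g.1 < h.1, h.1 < g.2 & g.2 < h.2].

Definition is_triangulation n (T : {set edge n}) : bool :=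
  [&& [forall g in T, g.1 < g.2],
      [forall g : edge n, is_side g ==> (g \in T)],
      [forall g in T, forall h in T, ~~ crossing g h] &
      #|[set g in T | ~~ is_side g]| == n.-1].

Definition triangulation (n : nat) : Type :=
  {T : {set edge n} | is_triangulation T}.

(* Third vertex of the triangle containing g = (a, b) in the sub-polygon with
   vertices a, a+1, ..., b. As the labels increase counterclockwise, the other
   two edges of that triangle are f_L(g) = (a, c) and f_R(g) = (c, b). *)
Definition apex n (T : {set edge n}) (g : edge n) : option 'I_n.+2 :=
  [pick c : 'I_n.+2 | [&& g.1 < c, c < g.2, (g.1, c) \in T & (c, g.2) \in T]].

Inductive direction := dirL | dirR.

(* The edges that occur as distinguished edges in the recursive definition. *)
Inductive distinguished n (T : {set edge n}) : edge n -> Prop :=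
| dist_base : distinguished T (base_edge n)
| dist_fL g c : distinguished T g -> apex T g = Some c ->
    distinguished T (g.1, c)
| dist_fR g c : distinguished T g -> apex T g = Some c ->
    distinguished T (c, g.2).

(* Graph of the map F : T \ {e} -> {L, R}. *)
Inductive F_graph n (T : {set edge n}) : edge n -> direction -> Prop :=
| F_fL g c : distinguished T g -> apex T g = Some c ->
    F_graph T (g.1, c) dirL
| F_fR g c : distinguished T g -> apex T g = Some c ->
    F_graph T (c, g.2) dirR.

(* For 1 <= k <= n the two sets below are singletons, see [left_nbP] and
   [right_nbP]; the default values are irrelevant. *)
Definition left_nb n (T : {set edge n}) (k : 'I_n.+2) : 'I_n.+2 :=
  xget ord0 [set j : 'I_n.+2 | (j < k)%N /\ F_graph T (j, k) dirL]%classic.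

Definition right_nb n (T : {set edge n}) (k : 'I_n.+2) : 'I_n.+2 :=
  xget ord0 [set j : 'I_n.+2 | (k < j)%N /\ F_graph T (k, j) dirR]%classic.

Inductive bintree := Empty | Node of bintree & bintree.

Fixpoint nodes (B : bintree) : nat :=
  if B is Node l r then (nodes l + nodes r).+1 else 0.

Definition bintree_of (n : nat) : Type := {B : bintree | nodes B == n}.

(* The recursion has depth at most the number of triangles of the
   sub-polygon, so that fuel n suffices for the (n+2)-gon. *)
Fixpoint dual_tree_rec n (T : {set edge n}) (fuel : nat) (g : edge n) :
    bintree :=
  if fuel is m.+1 then
    if apex T g is Some c then
      Node (dual_tree_rec T m (g.1, c)) (dual_tree_rec T m (c, g.2))
    else Empty
  else Empty.

Definition dual_tree n (T : {set edge n}) : bintree :=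
  dual_tree_rec T n (base_edge n).

Section DualTreeTheory.

Variable n : nat.
Implicit Types (T : {set edge n}) (g h : edge n) (B : bintree).

Definition edges_in T (a b : nat) : {set edge n} :=
  [set g in T | (a <= g.1) && (g.2 <= b)].

Definition planar T :=
  (forall g, g \in T -> g.1 < g.2) /\
  (forall g h, g \in T -> h \in T -> ~~ crossing g h).

Lemma edges_in_split T (a b : 'I_n.+2) : planar T -> a.+1 < b ->
  exists c : 'I_n.+2, [/\ a < c, c < b &
    edges_in T a b \subset (a, b) |: (edges_in T a c :|: edges_in T c b)].
Proof.
move=> [Tlt Tnc] ab.
have cover (c : 'I_n.+2) : a < c -> c < b ->
    (forall g, g \in T -> a <= g.1 -> g.2 <= b -> g.1 < c -> c < g.2 ->
      g.1 = a /\ g.2 = b) ->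
    edges_in T a b \subset (a, b) |: (edges_in T a c :|: edges_in T c b).
  move=> ac cb H; apply/subsetP => -[x y]; rewrite !inE /= => /and3P[gT ax yb].
  rewrite gT ax yb /= andbT.
  case: (leqP y c) => [|cy]; first by rewrite orbT.
  case: (leqP c x) => [|xc]; first by rewrite !orbT.
  by have [/= -> ->] := H (x, y) gT ax yb xc cy; rewrite eqxx.
case: (pickP [pred c : 'I_n.+2 | [&& a < c, c < b & (a, c) \in T]]).
  move=> c0 Pc0; case: (arg_maxnP (fun c : 'I_n.+2 => c : nat) Pc0).
  move=> c /and3P[ac cb acT] cmax; exists c; split=> //; apply: cover => //.
  move=> [x y] /= gT ax yb xc cy.
  have [xa|xa] := eqVneq x a.
    split=> //; apply/val_inj; apply/eqP; rewrite eqn_leq yb leqNgt.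
    apply/negP => yltb; have := cmax y; rewrite /= yltb -xa gT.
    by move/(_ ltac:(lia)); lia.
  have := Tnc _ _ acT gT; rewrite /crossing /= xc cy.
  have -> : a < x by rewrite ltn_neqAle ax andbT eq_sym.
  by [].
move=> none; have lt_c : a.+1 < n.+2 by have := ltn_ord b; lia.
exists (Ordinal lt_c); split=> //; apply: cover => // -[x y] /= gT ax yb xc cy.
have xa : x = a by apply: val_inj => /=; lia.
split=> //; apply/val_inj; apply/eqP; rewrite eqn_leq yb leqNgt.
apply/negP => yltb; have := none y; rewrite /= yltb -xa gT.
by move/negbT; rewrite /= andbT -ltnNge ltnS => ?; lia.
Qed.

Lemma edges_in1 T (a b : 'I_n.+2) : planar T -> b = a.+1 :> nat ->
  edges_in T a b \subset [set (a, b)].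
Proof.
move=> [Tlt _] ab; apply/subsetP => -[x y]; rewrite !inE /= => /and3P[gT ax yb].
have /= xy := Tlt _ gT.
by apply/eqP; congr pair; apply: val_inj => /=; lia.
Qed.

Lemma card_edges_in T (a b : 'I_n.+2) : planar T -> a < b ->
  #|edges_in T a b| <= ((b - a).-1).*2.+1.
Proof.
move=> pT; move: {2}(b - a) (leqnn (b - a)) => m.
elim: m a b => [|m IH] a b bam ab; first by lia.
have [abS|abS] := ltnP a.+1 b; last first.
  have E : b = a.+1 :> nat by lia.
  by have := subset_leq_card (edges_in1 pT E); rewrite cards1; lia.
have [c [ac cb /subset_leq_card]] := edges_in_split pT abS.
have := IH a c ltac:(lia) ac; have := IH c b ltac:(lia) cb.
rewrite cardsU1; have := cardsU (edges_in T a c) (edges_in T c b).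
by case: (_ \notin _) => /=; lia.
Qed.

Lemma apex_some T (a b c : 'I_n.+2) : planar T ->
  a < c -> c < b -> (a, c) \in T -> (c, b) \in T -> apex T (a, b) = Some c.
Proof.
move=> [Tlt Tnc] ac cb acT cbT; rewrite /apex /=.
case: pickP => [d /and4P[ad db adT dbT]|/(_ c)]; last by rewrite ac cb acT cbT.
congr Some; apply: val_inj => /=.
have := Tnc _ _ acT dbT; have := Tnc _ _ adT cbT; rewrite /crossing /=; lia.
Qed.

Definition full T (a b : 'I_n.+2) :=
  #|edges_in T a b| = ((b - a).-1).*2.+1.

Lemma full_edge T (a b : 'I_n.+2) : planar T -> a < b -> full T a b ->
  (a, b) \in T.
Proof.
move=> pT ab fab; have [abS|abS] := ltnP a.+1 b; last first.
  have E : b = a.+1 :> nat by lia.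
  have /eqP: edges_in T a b == [set (a, b)].
    by rewrite eqEcard (edges_in1 pT E) cards1 fab.
  by move/setP/(_ (a, b)); rewrite !inE eqxx => /andP[].
have [c [ac cb sub]] := edges_in_split pT abS.
apply/contraT => abT; have : edges_in T a b \subset
    (edges_in T a c :|: edges_in T c b).
  apply/subsetP => g gab; have := subsetP sub g gab.
  case/setU1P => // gE; move: gab; rewrite gE !inE (negbTE abT) //.
move/subset_leq_card; rewrite cardsU fab.
have := card_edges_in pT ac; have := card_edges_in pT cb; lia.
Qed.

Lemma full_split T (a b : 'I_n.+2) : planar T -> a.+1 < b -> full T a b ->
  exists c : 'I_n.+2, [/\ a < c, c < b, apex T (a, b) = Some c,
    full T a c /\ full T c b &
    edges_in T a b = (a, b) |: (edges_in T a c :|: edges_in T c b)].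
Proof.
move=> pT abS fab; have [c [ac cb sub]] := edges_in_split pT abS.
have abT : (a, b) \in T by apply: full_edge => //; lia.
exists c; have [fac fcb] : full T a c /\ full T c b.
  have := subset_leq_card sub; rewrite cardsU1 cardsU fab.
  have := card_edges_in pT ac; have := card_edges_in pT cb; rewrite /full.
  by case: (_ \notin _) => /=; lia.
split=> //; first by apply: apex_some => //; apply: full_edge.
apply/eqP; rewrite eqEsubset sub; apply/subsetP => -[x y].
case/setU1P => [[-> ->]|]; first by rewrite !inE abT !leqnn.
by rewrite !inE /=; lia.
Qed.

Fixpoint tree_edges (a : nat) B : seq (nat * nat) :=
  (a, a + (nodes B).+1) ::
  (if B is Node l r then
     tree_edges a l ++ tree_edges (a + (nodes l).+1) r
   else [::]).

Lemma full_dual_tree T m (a b : 'I_n.+2) : planar T -> a < b -> full T a b ->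
  b - a <= m.+1 ->
  let B := dual_tree_rec T m (a, b) in
  b = a + (nodes B).+1 :> nat /\
  forall x y : 'I_n.+2,
    ((x, y) \in edges_in T a b) = ((val x, val y) \in tree_edges a B).
Proof.
move=> pT; elim: m a b => [|m IH] a b ab fab bam.
  have E : b = a.+1 :> nat by lia.
  split=> /= [|x y]; first by lia.
  have -> : edges_in T a b = [set (a, b)].
    by apply/eqP; rewrite eqEcard (edges_in1 pT E) cards1 fab.
  by rewrite !inE -!pair_eqE /= -!val_eqE /= E addn1.
have [abS|abS] := ltnP a.+1 b; last first.
  have E : b = a.+1 :> nat by lia.
  rewrite /= /apex; case: pickP => [c /and4P[/= ? ? _ _]|_]; first by lia.
  split=> /= [|x y]; first by lia.
  have -> : edges_in T a b = [set (a, b)].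
    by apply/eqP; rewrite eqEcard (edges_in1 pT E) cards1 fab.
  by rewrite !inE -!pair_eqE /= -!val_eqE /= E addn1.
have [c [ac cb apE [fac fcb] edE]] := full_split pT abS fab.
have [cE memL] := IH a c ac fac ltac:(lia).
have [bE memR] := IH c b cb fcb ltac:(lia).
rewrite /= apE /=; split; first by lia.
move=> x y; rewrite edE in_setU1 in_setU memL memR inE mem_cat -cE.
rewrite -!pair_eqE /= -!val_eqE /=.
by congr [|| _ && (_ == _), _ | _]; lia.
Qed.

Lemma card_sides : #|[set g : edge n | is_side g]| = n + 1 + (n != 0).
Proof.
have -> : [set g : edge n | is_side g] =
   base_edge n |: [set (widen_ord (leqnSn _) k, lift ord0 k) | k : 'I_n.+1].
  apply/setP => -[x y]; rewrite !inE /is_side orbC; congr orb.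
  apply/eqP/imsetP => [/= yE|[k _ [-> ->]]] //=.
  have xlt : x < n.+1 by have := ltn_ord y; lia.
  by exists (Ordinal xlt) => //; congr pair; apply: val_inj.
rewrite cardsU1 card_imset; last first.
  by move=> i j /(congr1 (fun g => val g.1)) /= ij; apply: val_inj.
rewrite card_ord addnC; case: n => [|m].
  rewrite (_ : _ \notin _ = false) //; apply/negbF/imsetP; exists ord0 => //.
  by congr pair; apply: val_inj.
rewrite (_ : _ \notin _ = true) ?addn1 //; apply/imsetP => -[k _ E].
have /= := congr1 (fun g : 'I_m.+3 * 'I_m.+3 => val g.1) E.
by have /= := congr1 (fun g : 'I_m.+3 * 'I_m.+3 => val g.2) E; rewrite /bump; lia.
Qed.

Lemma triangulation_planar T : is_triangulation T -> planar T.
Proof.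
case/and4P => /forall_inP lt _ /forall_inP nc _; split=> // g h gT hT.
by move/forall_inP: (nc g gT) => /(_ h hT).
Qed.

Lemma triangulation_full T : is_triangulation T -> full T ord0 ord_max.
Proof.
case/and4P => _ /forallP sT _ /eqP dT.
have -> : full T ord0 ord_max = (#|T| = n.*2.+1).
  rewrite /full subn0 /=; congr (#|pred_of_set _| = _).
  by apply/setP => g; rewrite !inE /= -ltnS ltn_ord andbT.
have := cardsID [set g : edge n | is_side g] T.
have -> : T :&: [set g : edge n | is_side g] = [set g : edge n | is_side g].
  by apply/setIidPr/subsetP => g; rewrite inE => /(implyP (sT g)).
have -> : T :\: [set g : edge n | is_side g] = [set g in T | ~~ is_side g].
  by apply/setP => g; rewrite !inE andbC.
by rewrite card_sides dT => <-; case: (n) => //= m; lia.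
Qed.

Lemma nodes_dual_tree (T : triangulation n) : nodes (dual_tree (val T)) == n.
Proof.
have pT := triangulation_planar (valP T).
have fT := triangulation_full (valP T).
have ltE : (ord0 : 'I_n.+2) < (ord_max : 'I_n.+2) by [].
have leE : (ord_max : 'I_n.+2) - (ord0 : 'I_n.+2) <= n.+1 by [].
have [/= + _] := full_dual_tree (m := n) pT ltE fT leE.
by rewrite add0n => -[/esym/eqP].
Qed.

Definition tree_set B : {set edge n} :=
  [set g : edge n | (val g.1, val g.2) \in tree_edges 0 B].

Lemma tree_edges_bound a B x y : (x, y) \in tree_edges a B ->
  [/\ a <= x, x < y & y <= a + (nodes B).+1].
Proof.
elim: B a => [|l IHl r IHr] a /=; first by rewrite inE => /eqP[-> ->]; split; lia.
rewrite inE mem_cat => /or3P[/eqP[-> ->]|/IHl[? ? ?]|/IHr[? ? ?]]; split; lia.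
Qed.

Lemma tree_edges_uniq a B :
  uniq (tree_edges a B) /\ size (tree_edges a B) = (nodes B).*2.+1.
Proof.
elim: B a => [|l IHl r IHr] a //=.
have [ul sl] := IHl a; have [ur sr] := IHr (a + (nodes l).+1).
split; last by rewrite size_cat sl sr; lia.
rewrite cat_uniq ul ur mem_cat andbT /=; apply/andP; split.
  by apply/negP => /orP[/tree_edges_bound[]|/tree_edges_bound[]]; lia.
by apply/hasPn => -[x y] /tree_edges_bound[? ? ?]; apply/negP => /tree_edges_bound[]; lia.
Qed.

Lemma tree_edges_noncrossing a B x y z t :
  (x, y) \in tree_edges a B -> (z, t) \in tree_edges a B ->
  ~~ [&& x < z, z < y & y < t].
Proof.
elim: B a => [|l IHl r IHr] a /=.
  by rewrite !inE => /eqP[-> ->] /eqP[-> ->]; lia.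
rewrite !inE !mem_cat => /or3P[/eqP[-> ->]|gl|gr] /or3P[/eqP[-> ->]|hl|hr];
  try (exact: IHl gl hl); try (exact: IHr gr hr);
  try (move: (tree_edges_bound gl) => [? ? ?]);
  try (move: (tree_edges_bound gr) => [? ? ?]);
  try (move: (tree_edges_bound hl) => [? ? ?]);
  try (move: (tree_edges_bound hr) => [? ? ?]); lia.
Qed.

Lemma tree_edges_side a B x : a <= x -> x <= a + nodes B ->
  (x, x.+1) \in tree_edges a B.
Proof.
elim: B a => [|l IHl r IHr] a /= ax xb; rewrite inE.
  by apply/eqP; congr pair; lia.
rewrite mem_cat; have [xl|xl] := leqP x (a + nodes l); first by rewrite IHl ?orbT.
by rewrite IHr ?orbT //; lia.
Qed.

Lemma tree_edges_base a B : (a, a + (nodes B).+1) \in tree_edges a B.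
Proof. by case: B => *; rewrite inE eqxx. Qed.

Lemma tree_set_planar B : planar (tree_set B).
Proof.
split=> [[x y]|[x y] [z t]]; rewrite !inE /=; first by case/tree_edges_bound.
exact: tree_edges_noncrossing.
Qed.

Lemma card_tree_set B : nodes B = n -> #|tree_set B| = n.*2.+1.
Proof.
move=> Bn; have [uB] := tree_edges_uniq 0 B; rewrite Bn => <-.
pose code (g : edge n) := (val g.1, val g.2).
have code_inj : injective code.
  by move=> [x y] [z t] [xz yt]; congr pair; apply: val_inj.
rewrite cardE -(size_map code); apply/perm_size/uniq_perm => //.
  by rewrite map_inj_uniq ?enum_uniq.
move=> [x y]; apply/mapP/idP => [[g]|xyB].
  by rewrite mem_enum inE => gB ->.
have [_ xy yb] := tree_edges_bound xyB.
have ylt : y < n.+2 by lia.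
have xlt : x < n.+2 by lia.
by exists (Ordinal xlt, Ordinal ylt) => //; rewrite mem_enum inE.
Qed.

Lemma tree_set_triangulation B : nodes B = n -> is_triangulation (tree_set B).
Proof.
move=> Bn; have [lt nc] := tree_set_planar B.
have sideB g : is_side g -> g \in tree_set B.
  case: g => x y; rewrite inE => /orP[/eqP /= E|/eqP[-> ->] /=].
    by rewrite E tree_edges_side //; have := ltn_ord y; lia.
  by have := tree_edges_base 0 B; rewrite Bn add0n.
apply/and4P; split.
- exact/forall_inP.
- by apply/forallP => g; apply/implyP/sideB.
- by apply/forall_inP => g gB; apply/forall_inP => h; apply: nc.
have := cardsID [set g : edge n | is_side g] (tree_set B).
have -> : tree_set B :&: [set g : edge n | is_side g] =
    [set g : edge n | is_side g].
  by apply/setIidPr/subsetP => g; rewrite inE => /sideB.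
have -> : tree_set B :\: [set g : edge n | is_side g] =
    [set g in tree_set B | ~~ is_side g].
  by apply/setP => g; rewrite !inE andbC.
rewrite card_sides card_tree_set // => E; apply/eqP; move: E.
by case: (n) #|[set g in tree_set B | ~~ is_side g]| => [|m] d /=; lia.
Qed.

Lemma dual_tree_rec_sub T m (a b : 'I_n.+2) B : planar T ->
  (forall x y : 'I_n.+2, (val x, val y) \in tree_edges a B -> (x, y) \in T) ->
  b = a + (nodes B).+1 :> nat -> nodes B <= m ->
  dual_tree_rec T m (a, b) = B.
Proof.
move=> pT; elim: m a b B => [|m IH] a b [|l r] //= sub bE mB.
  by rewrite /apex; case: pickP => // c /and4P[/= ? ? _ _]; lia.
have clt : a + (nodes l).+1 < n.+2 by have := ltn_ord b; lia.
pose c := Ordinal clt.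
have -> : apex T (a, b) = Some c.
  apply: apex_some => //=; try lia; apply: sub => /=.
    by rewrite inE mem_cat tree_edges_base orbT.
  have -> : nat_of_ord b = a + (nodes l).+1 + (nodes r).+1 by rewrite bE /=; lia.
  by rewrite inE mem_cat tree_edges_base !orbT.
congr Node; apply: IH => //=; try lia.
- by move=> x y xy; apply: sub; rewrite inE mem_cat xy orbT.
- by move=> x y xy; apply: sub; rewrite inE mem_cat xy !orbT.
Qed.

End DualTreeTheory.

Definition tree_of_triangulation n (T : triangulation n) : bintree_of n :=
  exist (fun B => nodes B == n) (dual_tree (val T)) (nodes_dual_tree T).

Lemma tree_of_triangulation_inj n : injective (@tree_of_triangulation n).
Proof.
move=> T1 T2 /(congr1 val) /= E; apply: val_inj; apply/setP => -[x y].
have all T : ((x, y) \in edges_in T 0 n.+1) = ((x, y) \in T).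
  by rewrite inE /= -ltnS ltn_ord andbT.
have mem (T : triangulation n) : ((x, y) \in val T) =
    ((val x, val y) \in tree_edges 0 (dual_tree (val T))).
  have pT := triangulation_planar (valP T).
  have fT := triangulation_full (valP T).
  have ltE : (ord0 : 'I_n.+2) < (ord_max : 'I_n.+2) by [].
  have leE : (ord_max : 'I_n.+2) - (ord0 : 'I_n.+2) <= n.+1 by [].
  have [_ /(_ x y) <-] := full_dual_tree (m := n) pT ltE fT leE.
  by rewrite all.
by rewrite !mem E.
Qed.

Lemma tree_of_triangulation_surj n (B : bintree_of n) :
  exists T : triangulation n, tree_of_triangulation T = B.
Proof.
case: B => B Bn; have Bn' := eqP Bn.
exists (exist (@is_triangulation n) (tree_set n B) (tree_set_triangulation Bn')).
apply: eq_exist => /=.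
apply: dual_tree_rec_sub; rewrite ?Bn' //; first exact: tree_set_planar.
by move=> x y; rewrite inE.
Qed.

(* The inverse of the bijection T |-> B_T. *)
Definition triangulation_of_tree n (B : bintree_of n) : triangulation n :=
  projT1 (cid (tree_of_triangulation_surj B)).

Lemma triangulation_of_treeK n :
  cancel (@triangulation_of_tree n) (@tree_of_triangulation n).
Proof. by move=> B; rewrite /triangulation_of_tree; case: cid. Qed.

Lemma tree_of_triangulationK n :
  cancel (@tree_of_triangulation n) (@triangulation_of_tree n).
Proof.
by move=> T; apply: tree_of_triangulation_inj; rewrite triangulation_of_treeK.
Qed.

Lemma apexP n (T : {set edge n}) g c : apex T g = Some c ->
  [/\ g.1 < c, c < g.2, (g.1, c) \in T & (c, g.2) \in T].
Proof. by rewrite /apex; case: pickP => // d /and4P[? ? ? ?] [<-]. Qed.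

Lemma distinguished_in n (T : triangulation n) g :
  distinguished (val T) g -> g \in val T.
Proof.
elim=> [|h c _ _ /apexP[]|h c _ _ /apexP[]] //.
by have /and4P[_ /forallP/(_ (base_edge n))] := valP T; rewrite /is_side eqxx orbT.
Qed.

Lemma distinguished_apex n (T : triangulation n) (k : 'I_n.+2) : 0 < k <= n ->
  exists2 g, distinguished (val T) g & apex (val T) g = Some k.
Proof.
move=> kn; have pT := triangulation_planar (valP T).
have fT := triangulation_full (valP T).
suff H m (a b : 'I_n.+2) : b - a <= m -> a < k < b ->
    full (val T) a b -> distinguished (val T) (a, b) ->
    exists2 g, distinguished (val T) g & apex (val T) g = Some k.
  by apply: (H n.+1 ord0 ord_max) => //=; exact: dist_base.
elim: m a b => [|m IH] a b bam kab fab dab; first by lia.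
have abS : a.+1 < b by lia.
have [c [ac cb apE [fac fcb] _]] := full_split pT abS fab.
case: (ltngtP k c) => [kc|ck|/val_inj ->]; last by exists (a, b).
- apply: (IH a c) => //; try lia.
  exact: (@dist_fL _ _ (a, b)).
- apply: (IH c b) => //; try lia.
  exact: (@dist_fR _ _ (a, b)).
Qed.

Lemma F_graphL n (T : {set edge n}) g : F_graph T g dirL ->
  exists2 b, distinguished T (g.1, b) & apex T (g.1, b) = Some g.2.
Proof.
move E : dirL => d Fg; case: Fg E => // -[a b] c dg ag _.
by exists b.
Qed.

Lemma F_graphR n (T : {set edge n}) g : F_graph T g dirR ->
  exists2 a, distinguished T (a, g.2) & apex T (a, g.2) = Some g.1.
Proof.
move E : dirR => d Fg; case: Fg E => // -[a b] c dg ag _.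
by exists a.
Qed.

Lemma left_nbP n (T : triangulation n) (k j : 'I_n.+2) : 0 < k <= n ->
  (j < k /\ F_graph (val T) (j, k) dirL) <-> j = left_nb (val T) k.
Proof.
move=> kn; have [_ nc] := triangulation_planar (valP T).
have [[a b] dab apE] := distinguished_apex T kn.
have [/= ak kb akT kbT] := apexP apE.
have Fa : a < k /\ F_graph (val T) (a, k) dirL by split=> //; apply: (F_fL dab).
have uniq (i : 'I_n.+2) : i < k /\ F_graph (val T) (i, k) dirL -> i = a.
  move=> [_ /F_graphL[/= x dix apx]]; have [/= ik kx ikT kxT] := apexP apx.
  have := nc _ _ akT (distinguished_in dix).
  have := nc _ _ ikT (distinguished_in dab).
  by rewrite /crossing /= => ? ?; apply: val_inj => /=; lia.
rewrite /left_nb (_ : xget _ _ = a); last exact: xget_unique.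
by split=> [/uniq|->].
Qed.

Lemma right_nbP n (T : triangulation n) (k j : 'I_n.+2) : 0 < k <= n ->
  (k < j /\ F_graph (val T) (k, j) dirR) <-> j = right_nb (val T) k.
Proof.
move=> kn; have [_ nc] := triangulation_planar (valP T).
have [[a b] dab apE] := distinguished_apex T kn.
have [/= ak kb akT kbT] := apexP apE.
have Fb : k < b /\ F_graph (val T) (k, b) dirR by split=> //; apply: (F_fR dab).
have uniq (i : 'I_n.+2) : k < i /\ F_graph (val T) (k, i) dirR -> i = b.
  move=> [_ /F_graphR[/= x dxi apx]]; have [/= xk ki xkT kiT] := apexP apx.
  have := nc _ _ (distinguished_in dxi) kbT.
  have := nc _ _ (distinguished_in dab) kiT.
  by rewrite /crossing /= => ? ?; apply: val_inj => /=; lia.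
rewrite /right_nb (_ : xget _ _ = b); last exact: xget_unique.
by split=> [/uniq|->].
Qed.

Definition min_index (s : seq nat) : nat := index (foldr minn (head 0 s) s) s.

(* The recursion has depth at most size s. *)
Fixpoint increasing_tree (fuel : nat) (s : seq nat) : bintree :=
  if fuel is m.+1 then
    if s is [::] then Empty
    else Node (increasing_tree m (take (min_index s) s))
              (increasing_tree m (drop (min_index s).+1 s))
  else Empty.

(* Values are shifted by one: 'I_n is {0, ..., n-1}. *)
Definition one_line n (u : 'S_n) : seq nat := [seq val (u i) | i <- enum 'I_n].

Definition psi_tree n (u : 'S_n) : bintree := increasing_tree n (one_line u).

Lemma min_index_lt x s : min_index (x :: s) < size (x :: s).
Proof.
rewrite /min_index index_mem.
have H y t : foldr minn y t \in y :: t.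
  elim: t => [|z t IH]; first by rewrite inE.
  rewrite [foldr _ _ _]/= /minn !inE; case: ifP => _; first by rewrite eqxx orbT.
  by move: IH; rewrite inE => /orP[->|->] //; rewrite !orbT.
by have := H x (x :: s); rewrite inE => /orP[/eqP->|//]; rewrite inE eqxx.
Qed.

Lemma nodes_increasing_tree m s : size s <= m ->
  nodes (increasing_tree m s) = size s.
Proof.
elim: m s => [|m IH] [|x s] //= sm.
have := min_index_lt x s; rewrite /= => lt.
rewrite !IH; first (rewrite size_take size_drop /=; case: ifP => ?; lia).
  by rewrite size_drop /=; lia.
by rewrite size_take /=; case: ifP => ?; lia.
Qed.

Lemma nodes_psi_tree n (u : 'S_n) : nodes (psi_tree u) == n.
Proof. by rewrite nodes_increasing_tree size_map size_enum_ord. Qed.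

Definition psi n (u : 'S_n) : triangulation n :=
  triangulation_of_tree
    (exist (fun B => nodes B == n) (psi_tree u) (nodes_psi_tree u)).

(* Composition of maps, (u o v)(i) = u (v i); the product of permutations in
   fingroup is in the opposite order. *)
Definition perm_comp n (u v : 'S_n) : 'S_n := (v * u)%g.

(* The Coxeter length, computed as the number of inversions. *)
Definition perm_length n (w : 'S_n) : nat :=
  #|[set p : 'I_n * 'I_n | (p.1 < p.2) && (w p.2 < w p.1)]|.

Definition bruhat_step n : rel 'S_n := fun v w =>
  [exists p : 'I_n * 'I_n, w == perm_comp v (tperm p.1 p.2)] &&
  (perm_length v < perm_length w).

Definition bruhat_le n : rel 'S_n := connect (@bruhat_step n).

(* s_1 s_2 ... s_n in S_{n+1}, where s_{i+1} exchanges the (0-based) values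
   i and i+1. *)
Definition s1n n : 'S_n.+1 :=
  \big[@perm_comp n.+1/1%g]_(i < n)
    tperm (widen_ord (leqnSn n) i) (lift ord0 i).

Definition perm_h n (u : 'S_n) : 'S_n.+1 := lift_perm ord0 ord0 u.

Local Open Scope ring_scope.
Local Open Scope quotient_scope.

Section Fans.

Variables (R : realType) (n : nat).

Notation rV := 'rV[R]_n.+1.

Definition ones_line : {pred rV} := fun x => (x <= (const_mx 1 : rV))%MS.

Lemma ones_line_zmod_closed : zmod_closed ones_line.
Proof.
split=> [|x y]; rewrite !unfold_in /ones_line ?sub0mx // => xl yl.
by rewrite addmx_sub // eqmx_opp.
Qed.

HB.instance Definition _ :=
  GRing.isZmodClosed.Build rV ones_line ones_line_zmod_closed.

Lemma ones_lineZ (a : R) x : x \in ones_line -> a *: x \in ones_line.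
Proof. exact: scalemx_sub. Qed.

(* N (x) R = R^{n+1} / R(1, ..., 1) *)
Definition NR : Type := Quotient.quot ones_line.

HB.instance Definition _ := GRing.Zmodule.on NR.
HB.instance Definition _ := EqQuotient.on NR.

Definition NR_proj (x : rV) : NR := \pi_NR x.

Lemma NR_projE x y : (NR_proj x == NR_proj y) = (x - y \in ones_line).
Proof. by rewrite /NR_proj -Quotient.idealrBE. Qed.

Lemma NR_proj_is_zmod_morphism : zmod_morphism NR_proj.
Proof. exact: (pi_is_zmod_morphism (Quotient.quot ones_line)). Qed.

HB.instance Definition _ :=
  GRing.isZmodMorphism.Build rV NR NR_proj NR_proj_is_zmod_morphism.

Lemma NR_reprK : cancel generic_quotient.repr NR_proj.
Proof. by move=> x; rewrite /NR_proj reprK. Qed.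

Definition NR_scale (a : R) (x : NR) : NR :=
  NR_proj (a *: generic_quotient.repr x).

Lemma NR_scale_proj a x : NR_scale a (NR_proj x) = NR_proj (a *: x).
Proof.
apply/eqP; rewrite NR_projE -scalerBr ones_lineZ // -NR_projE.
by rewrite NR_reprK.
Qed.

Lemma NR_scaleA a b x : NR_scale a (NR_scale b x) = NR_scale (a * b) x.
Proof. by rewrite {2}/NR_scale NR_scale_proj scalerA. Qed.

Lemma NR_scale1 : left_id 1 NR_scale.
Proof. by move=> x; rewrite /NR_scale scale1r NR_reprK. Qed.

Lemma NR_scaleDr : right_distributive NR_scale +%R.
Proof.
move=> a x y; rewrite -[x]NR_reprK -[y]NR_reprK -raddfD !NR_scale_proj.
by rewrite scalerDr raddfD.
Qed.

Lemma NR_scaleDl x : {morph NR_scale^~ x : a b / a + b}.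
Proof. by move=> a b; rewrite /NR_scale scalerDl raddfD. Qed.

HB.instance Definition _ := GRing.Zmodule_isLmodule.Build R NR
  NR_scaleA NR_scale1 NR_scaleDr NR_scaleDl.

Lemma NR_proj_is_scalable : scalable NR_proj.
Proof. by move=> a x; rewrite -NR_scale_proj. Qed.

HB.instance Definition _ :=
  GRing.isScalable.Build R rV NR *:%R NR_proj NR_proj_is_scalable.

Definition dot (x y : rV) : R := \sum_(i < n.+1) x 0 i * y 0 i.

(* Pairing of N (x) R with M (x) R = {m | \sum_i m_i = 0}; it is independent of
   the chosen representative only for such m, see [NR_pairing_proj]. *)
Definition NR_pairing (x : NR) (m : rV) : R :=
  dot (generic_quotient.repr x) m.

Lemma NR_pairing_proj (x m : rV) : \sum_(i < n.+1) m 0 i = 0 ->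
  NR_pairing (NR_proj x) m = dot x m.
Proof.
move=> m0; apply/eqP; rewrite -subr_eq0 /NR_pairing /dot -sumrB.
have : generic_quotient.repr (NR_proj x) - x \in ones_line.
  by rewrite -NR_projE NR_reprK.
move=> /sub_rVP[a E]; apply/eqP.
rewrite -[RHS](mulr0 a) -[in RHS]m0 mulr_sumr.
apply: eq_bigr => i _; rewrite -mulrBl; congr (_ * _).
by have := congr1 (fun v : rV => v 0 i) E; rewrite !mxE mulr1.
Qed.

(* Coordinates are 0-based: k < i selects e_1, ..., e_i. *)
Definition varpi (i : 'I_n.+2) : NR :=
  NR_proj (\sum_(k < n.+1 | (k < i)%N) delta_mx 0 k).

Definition ray_v (T : triangulation n) (k : 'I_n.+2) : NR :=
  varpi k - varpi (right_nb (val T) k).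

Definition ray_w (T : triangulation n) (k : 'I_n.+2) : NR :=
  varpi (left_nb (val T) k) - varpi k.

Local Open Scope classical_set_scope.

Definition Cone (Q : set NR) : set NR :=
  [set x | exists (m : nat) (q : 'I_m -> NR) (c : 'I_m -> R),
    (forall i, Q (q i) /\ 0 <= c i) /\ x = \sum_(i < m) c i *: q i].

Definition inner_vertex : set 'I_n.+2 := [set k : 'I_n.+2 | (0 < k <= n)%N].

Definition fan_of (T : triangulation n) : set (set NR) :=
  [set C | exists Q : set NR,
    [/\ Q `<=` (ray_v T @` inner_vertex) `|` (ray_w T @` inner_vertex),
        forall i, inner_vertex i -> ~ ([set ray_v T i; ray_w T i] `<=` Q) &
        C = Cone Q]].

Definition convex_hull (A : set rV) : set rV := smallest (@convex_set R rV) A.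

Definition perm_point (z : 'S_n.+1) : rV := \row_i (z i).+1%:R.

Definition bruhat_polytope (v w : 'S_n.+1) : set rV :=
  convex_hull [set perm_point z | z in
    [set z : 'S_n.+1 | bruhat_le v z && bruhat_le z w]].

(* Faces of a polytope: its intersections with the hyperplanes {c . y = b}
   such that the inequality c . y >= b is valid on it. *)
Definition is_face (P E : set rV) : Prop :=
  exists (c : rV) (b : R), (forall y, P y -> b <= dot c y) /\
    E = P `&` [set y | dot c y = b].

Definition normal_cone (P E : set rV) : set NR :=
  [set x | forall y p, P y -> E p -> 0 <= NR_pairing x (y - p)].

(* Only meaningful if \sum_i y_i is constant on P. *)
Definition normal_fan (P : set rV) : set (set NR) :=
  [set C | exists E, [/\ is_face P E, E !=set0 & C = normal_cone P E]].

End Fans.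

(* Main.v *)
Require Import Defs.
From mathcomp Require Import boolp classical_sets convex.
From mathcomp Require Import all_boot all_order all_algebra all_fingroup reals.
From mathcomp Require Import zify ring interval_inference.

(** Write a(0) = 0, a(1), ..., a(n) for the one-line notation of [perm_h u], with
    the further convention a(n+1) = 0. In the triangulation [psi u], k_L and k_R
    are the nearest positions on either side of k carrying a smaller value of a.
    For z in the Bruhat interval, comparing the rank functions of z with those of
    the endpoints gives, for every window [l, r) of positions,
      z(l) + ... + z(r-1) <= a(l) + ... + a(r) - min (a(l), ..., a(r)).
    The windows [k, k_R) and [k_L, k) give the inequalities with normals v_k and
    w_k. Conversely, for each subset S of [n], pushing the value 0 through the
    increasing tree of u, exchanging it with the label of the node at each node
    of S, gives a permutation in the interval for which w_k is tight for k in S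
    and v_k is tight for k not in S; the window [k_L, k_R) shows that the other
    inequality at k is then strict. Moving k in or out of S changes only the
    tightness at k, so the polytope is a combinatorial cube and its normal fan
    can be read off. *)

Set Implicit Arguments.
Unset Strict Implicit.
Unset Printing Implicit Defensive.

Import Order.TTheory GRing.Theory Num.Theory.

(** * Pairing on the quotient *)

Section Pairing.

Local Open Scope ring_scope.

Variables (R : realType) (n : nat).
Implicit Types (x y : NR R n) (X Y m : 'rV[R]_n.+1).

(** Membership in M tensor R, where [NR_pairing] does not depend on the chosen representative; this
    gives linearity in the first argument. *)
Definition sum_zero m := \sum_(i < n.+1) m 0 i = 0.

Lemma dotDl X Y m : dot (X + Y) m = dot X m + dot Y m.
Proof.
by rewrite /dot -big_split; apply: eq_bigr => i _; rewrite !mxE mulrDl.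
Qed.

Lemma dotZl a X m : dot (a *: X) m = a * dot X m.
Proof. by rewrite /dot mulr_sumr; apply: eq_bigr => i _; rewrite !mxE mulrA. Qed.

Lemma pairingD x y m : sum_zero m ->
  NR_pairing (x + y) m = NR_pairing x m + NR_pairing y m.
Proof.
move=> m0; rewrite -[x]NR_reprK -[y]NR_reprK -raddfD.
by rewrite !NR_pairing_proj // dotDl.
Qed.

Lemma pairingZ a x m : sum_zero m ->
  NR_pairing (a *: x) m = a * NR_pairing x m.
Proof.
move=> m0; rewrite -[x]NR_reprK -linearZ.
by rewrite !NR_pairing_proj // dotZl.
Qed.

Lemma pairing0 m : sum_zero m -> NR_pairing 0 m = 0.
Proof. by move=> m0; rewrite -(scale0r 0) pairingZ // mul0r. Qed.

Lemma pairingN x m : sum_zero m -> NR_pairing (- x) m = - NR_pairing x m.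
Proof. by move=> m0; rewrite -scaleN1r pairingZ // mulN1r. Qed.

Lemma pairingNr x m : NR_pairing x (- m) = - NR_pairing x m.
Proof.
by rewrite /NR_pairing /dot -sumrN; apply: eq_bigr => i _; rewrite mxE mulrN.
Qed.

Lemma pairing_sum (I : Type) (r : seq I) (P : pred I) (F : I -> NR R n) m :
  sum_zero m ->
  NR_pairing (\sum_(i <- r | P i) F i) m =
  \sum_(i <- r | P i) NR_pairing (F i) m.
Proof.
move=> m0; apply: (big_morph (fun x => NR_pairing x m)) => [x y|].
  exact: pairingD.
exact: pairing0.
Qed.

Lemma pairingB x X Y : NR_pairing x (X - Y) = NR_pairing x X - NR_pairing x Y.
Proof.
rewrite /NR_pairing /dot -sumrB; apply: eq_bigr => i _.
by rewrite !mxE mulrBr.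
Qed.

End Pairing.

(** * Normal fans of combinatorial cubes *)

Section CubicalFan.

Local Open Scope ring_scope.
Local Open Scope classical_set_scope.

Variables (R : realType) (n : nat) (I : finType) (D : pred I).
Variables (v w : I -> NR R n) (P : set 'rV[R]_n.+1) (p : {set I} -> 'rV[R]_n.+1).

Implicit Types (S J : {set I}) (k j : I).

(** In the cube picture [p S] is a vertex, and [ray S k] is the inner normal of the facet through it
    in direction [k]. *)
Definition ray S k : NR R n := if k \in S then w k else v k.

Hypothesis P_sum : forall y z, P y -> P z -> sum_zero (y - z).
Hypothesis P_p : forall S, P (p S).
Hypothesis ray_ge0 : forall S k y, D k -> P y ->
  0 <= NR_pairing (ray S k) (y - p S).
Hypothesis ray_gt0 : forall (S S' : {set I}) k, D k -> (k \in S) != (k \in S') ->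
  0 < NR_pairing (ray S k) (p S' - p S).
Hypothesis ray_span : forall S x, exists c : I -> R,
  x = \sum_(k | D k) c k *: ray S k.

Definition flip S k : {set I} :=
  if k \in S then S :\ k else k |: S.

Lemma in_flip S j k : (j \in flip S k) = (j == k) (+) (j \in S).
Proof.
rewrite /flip; case: ifP => kS; rewrite !inE; case: eqVneq => [->|] //=.
  by rewrite kS.
by rewrite kS.
Qed.

Lemma ray_eq S S' k : (k \in S) = (k \in S') -> ray S k = ray S' k.
Proof. by rewrite /ray => ->. Qed.

Lemma ray_eq0 S S' k : D k -> (k \in S) = (k \in S') ->
  NR_pairing (ray S k) (p S' - p S) = 0.
Proof.
move=> Dk E; apply/eqP; rewrite eq_le ray_ge0 // andbT.
by rewrite (ray_eq E) -opprB pairingNr oppr_le0 ray_ge0.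
Qed.

Lemma pairing_comb S (c : I -> R) m : sum_zero m ->
  NR_pairing (\sum_(k | D k) c k *: ray S k) m =
  \sum_(k | D k) c k * NR_pairing (ray S k) m.
Proof.
by move=> m0; rewrite pairing_sum //; apply: eq_bigr => k _; rewrite pairingZ.
Qed.

(** The edge from [p S] to [p (flip S k)] is orthogonal to every other ray at [p S], so it reads off
    the coefficient [c k]. *)
Lemma pairing_flip S (c : I -> R) k : D k ->
  NR_pairing (\sum_(j | D j) c j *: ray S j) (p (flip S k) - p S) =
  c k * NR_pairing (ray S k) (p (flip S k) - p S).
Proof.
move=> Dk; rewrite pairing_comb; last exact: P_sum.
rewrite (bigD1 k) //= big1 ?addr0 // => j /andP[Dj jk].
by rewrite ray_eq0 ?mulr0 // in_flip (negbTE jk).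
Qed.

Lemma ray_flip_gt0 S k : D k -> 0 < NR_pairing (ray S k) (p (flip S k) - p S).
Proof. by move=> Dk; apply: ray_gt0 => //; rewrite in_flip eqxx; case: (_ \in _). Qed.

(** * Faces of the cube and their normal cones *)

Definition cube_face S (J : {set I}) : set 'rV[R]_n.+1 :=
  [set y | P y /\ forall k, D k -> k \in J -> NR_pairing (ray S k) (y - p S) = 0].

Definition rays S (J : {set I}) : set (NR R n) :=
  [set ray S k | k in [set k | D k /\ k \in J]].

Lemma Cone_comb S J (c : I -> R) :
  (forall k, D k -> k \in J -> 0 <= c k) ->
  Cone (rays S J) (\sum_(k | D k && (k \in J)) c k *: ray S k).
Proof.
move=> c0; pose A := [set k | D k && (k \in J)]%SET.
exists #|A|, (fun i => ray S (enum_val i)), (fun i => c (enum_val i)); split.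
  move=> i; have := enum_valP i; rewrite inE => /andP[Dk kJ].
  by split; [exists (enum_val i) | exact: c0].
rewrite -(big_enum_val (A := mem A) (fun k => c k *: ray S k)).
by apply: eq_bigl => k; rewrite inE.
Qed.

Lemma cube_face_p S J S' : (forall k, D k -> k \in J -> (k \in S) = (k \in S')) ->
  cube_face S J (p S').
Proof. by move=> H; split=> // k Dk kJ; rewrite ray_eq0 // H. Qed.

(** Pairing [x], expanded in the rays at [p S], with the edges there isolates each coefficient.
    Minimality at [p S] makes it nonnegative; for [k] outside [J] the vertex [p (flip S k)] lies on
    the face too, so the coefficient vanishes. *)
Lemma normal_cone_cube_face S J :
  normal_cone P (cube_face S J) = Cone (rays S J).
Proof.
apply/seteqP; split=> x.
  move=> nx; have [c xE] := ray_span S x.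
  have EpS : cube_face S J (p S) by exact: cube_face_p.
  have pflip k : D k -> NR_pairing x (p (flip S k) - p S) =
      c k * NR_pairing (ray S k) (p (flip S k) - p S).
    by move=> Dk; rewrite {1}xE pairing_flip.
  have c0 k : D k -> 0 <= c k.
    move=> Dk; rewrite -(pmulr_lge0 _ (ray_flip_gt0 S Dk)) -pflip //.
    exact: nx.
  have cJ k : D k -> k \notin J -> c k = 0.
    move=> Dk kJ; apply/eqP; rewrite eq_le c0 // andbT.
    rewrite -(pmulr_lle0 _ (ray_flip_gt0 S Dk)) -pflip // -opprB pairingNr oppr_le0.
    apply: nx => //; apply: cube_face_p => j Dj jJ; rewrite in_flip.
    by case: eqP => [jk|] //; rewrite jk (negbTE kJ) in jJ.
  rewrite xE (bigID (mem J)) /= [X in _ + X]big1 ?addr0.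
    by apply: Cone_comb => k Dk _; exact: c0.
  by move=> k /andP[Dk kJ]; rewrite cJ ?scale0r.
move=> [m [q [c [qc ->]]]] y z Py [Pz zE].
have yz : sum_zero (y - z) by exact: P_sum.
rewrite pairing_sum //; apply: sumr_ge0 => i _; rewrite pairingZ //.
have [[k [Dk kJ] <-] ci] := qc i; apply: mulr_ge0 => //.
have -> : y - z = (y - p S) - (z - p S) by rewrite opprB addrA subrK.
by rewrite pairingB zE // subr0 ray_ge0.
Qed.

(** A sum of nonnegative terms vanishes only termwise, so exactly the rays in the support of [c]
    must be tight. *)
Lemma cube_face_comb S J (c : I -> R) y : P y ->
  (forall k, D k -> 0 <= c k) -> (forall k, (c k != 0) = (k \in J)) ->
  NR_pairing (\sum_(k | D k) c k *: ray S k) (y - p S) = 0 <-> cube_face S J y.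
Proof.
move=> Py c0 cJ; rewrite pairing_comb; last exact: P_sum.
have t0 k : D k -> 0 <= c k * NR_pairing (ray S k) (y - p S).
  by move=> Dk; apply: mulr_ge0; [exact: c0 | exact: ray_ge0].
split=> [/psumr_eq0P E|[_ E]].
  split=> // k Dk kJ; have := E t0 k Dk; move/eqP; rewrite mulf_eq0.
  by rewrite -cJ in kJ; rewrite (negbTE kJ) => /eqP.
apply: big1 => k Dk; have [->|] := eqVneq (c k) 0; first by rewrite mul0r.
by rewrite cJ => kJ; rewrite E // mulr0.
Qed.

Lemma dot_pairing C y z : P y -> P z ->
  NR_pairing (NR_proj C) (y - z) = dot C y - dot C z.
Proof.
move=> Py Pz; rewrite NR_pairing_proj; last exact: P_sum.
rewrite /dot -sumrB; apply: eq_bigr => i _; by rewrite !mxE mulrBr.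
Qed.

(** The sum of the rays over the indices of [J] in [D] serves as supporting functional. *)
Lemma is_face_cube_face S J : is_face P (cube_face S J).
Proof.
pose c k : R := (k \in J)%:R.
pose x := \sum_(k | D k) c k *: ray S k.
have c0 k : D k -> 0 <= c k by rewrite /c ler0n.
have cJ k : (c k != 0) = (k \in J) by rewrite /c pnatr_eq0; case: (_ \in _).
pose C := generic_quotient.repr x.
have xy y : P y -> NR_pairing x (y - p S) = dot C y - dot C (p S).
  by move=> Py; rewrite -dot_pairing // NR_reprK.
exists C, (dot C (p S)); split=> [y Py|].
  rewrite -subr_ge0 -xy // pairing_comb; last exact: P_sum.
  by apply: sumr_ge0 => k Dk; apply: mulr_ge0; [exact: c0 | exact: ray_ge0].
apply/seteqP; split=> y.
  move=> Ey; have Py := Ey.1; split=> //=.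
  apply/eqP; rewrite -subr_eq0 -xy //; apply/eqP.
  exact/(cube_face_comb S Py c0 cJ).
move=> [Py /= E]; apply/(cube_face_comb S Py c0 cJ).
by rewrite xy // E subrr.
Qed.

(* Completeness of the fan: a vertex [p S] minimizing [x] among all of them has
   [x] in its cone, because [x] cannot decrease along the edges at [p S]. *)
Lemma cone_cover x : exists S (c : I -> R),
  (forall k, D k -> 0 <= c k) /\ x = \sum_(k | D k) c k *: ray S k.
Proof.
pose f S := NR_pairing x (p S).
have [S _ Smin] := @arg_minP _ _ _ (set0 : {set I}) predT f isT.
have [c xE] := ray_span S x; exists S, c; split=> // k Dk.
rewrite -(pmulr_lge0 _ (ray_flip_gt0 S Dk)) -pairing_flip // -xE.
by rewrite pairingB subr_ge0 Smin.
Qed.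

(** By [cone_cover] the defining functional is a nonnegative combination of the rays at some [p S].
    The support of the coefficients is [J], and [b] is the value at [p S] because the face is
    nonempty. *)
Lemma face_is_cube_face E : is_face P E -> E !=set0 ->
  exists S J, E = cube_face S J.
Proof.
move=> [C [b [bP ->]]] [y0 [Py0 /= y0b]].
have [S [c' [c0' xE]]] := cone_cover (NR_proj C).
(* Zero outside [D], so that [J] is the exact support of [c]. *)
pose c k := if D k then c' k else 0.
have c0 k : D k -> 0 <= c k by move=> Dk; rewrite /c Dk c0'.
have xE' : NR_proj C = \sum_(k | D k) c k *: ray S k.
  by rewrite xE; apply: eq_bigr => k Dk; rewrite /c Dk.
pose J := [set k | c k != 0]%SET.
have cJ k : (c k != 0) = (k \in J) by rewrite inE.
have ge0 y : P y -> 0 <= dot C y - dot C (p S).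
  move=> Py; rewrite -dot_pairing // xE' pairing_comb; last exact: P_sum.
  by apply: sumr_ge0 => k Dk; apply: mulr_ge0; [exact: c0 | exact: ray_ge0].
have bE : b = dot C (p S).
  by apply/eqP; rewrite eq_le bP // -y0b -subr_ge0 ge0.
exists S, J; apply/seteqP; split=> y.
  move=> [Py /= yb]; apply/(cube_face_comb S Py c0 cJ).
  by rewrite -xE' dot_pairing // yb bE subrr.
move=> Ey; have Py := Ey.1; split=> //=.
move/(cube_face_comb S Py c0 cJ): Ey; rewrite -xE' dot_pairing // bE.
by move/eqP; rewrite subr_eq0 => /eqP.
Qed.

(** All rays at [p S] are nonnegative on [p S' - p S], while the opposite ray at [k] is negative
    towards [p (flip S k)]. Signs are used because equal vectors might carry different indices. *)
Lemma rays_admissible S J k : D k -> ~ ([set v k; w k] `<=` rays S J).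
Proof.
move=> Dk sub.
have rayP x S' : rays S J x -> 0 <= NR_pairing x (p S' - p S).
  by move=> [j [Dj _] <-]; exact: ray_ge0.
have : rays S J (ray (flip S k) k).
  by apply: sub; rewrite /ray; case: ifP => _; [right | left].
move/(rayP _ (flip S k)); rewrite -opprB pairingNr oppr_ge0.
rewrite leNgt ray_gt0 // in_flip eqxx; by case: (_ \in _).
Qed.

Lemma admissible_rays Q :
  Q `<=` (v @` [set k | D k]) `|` (w @` [set k | D k]) ->
  (forall k, D k -> ~ ([set v k; w k] `<=` Q)) ->
  exists S J, Q = rays S J.
Proof.
(* [S] records where [w] is used; elsewhere only [v] can occur. Admissibility excludes both at
   once. *)
move=> Qsub Qadm; pose S := [set k | `[< Q (w k) >]]%SET.
pose J := [set k | `[< Q (ray S k) >]]%SET.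
exists S, J; apply/seteqP; split=> x; last first.
  by move=> [k [Dk +] <-]; rewrite inE => /asboolP.
move=> Qx; case: (Qsub x Qx) => -[k Dk E]; exists k.
- split=> //; rewrite inE; apply/asboolP; rewrite /ray; case: ifP.
    by rewrite inE => /asboolP.
  by rewrite E.
- rewrite /ray; case: ifP => // /[!inE] /asboolP Qw; exfalso; apply: (Qadm k Dk).
  by move=> _ [->|->] //; rewrite E.
- split=> //; rewrite inE; apply/asboolP; rewrite /ray inE.
  by case: asboolP => //; rewrite E.
- by rewrite /ray inE; case: asboolP => //; rewrite E.
Qed.

Theorem normal_fan_cube : normal_fan P =
  [set C | exists Q : set (NR R n),
    [/\ Q `<=` (v @` [set k | D k]) `|` (w @` [set k | D k]),
        forall k, D k -> ~ ([set v k; w k] `<=` Q) & C = Cone Q]].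
Proof.
apply/seteqP; split=> C.
  move=> [E [fE E0 ->]]; have [S [J ->]] := face_is_cube_face fE E0.
  exists (rays S J); split; last exact: normal_cone_cube_face.
    by move=> _ [k [Dk _] <-]; rewrite /ray; case: ifP => _; [right|left]; exists k.
  by move=> k; exact: rays_admissible.
move=> [Q [Qsub Qadm ->]]; have [S [J ->]] := admissible_rays Qsub Qadm.
exists (cube_face S J); split; first exact: is_face_cube_face.
  by exists (p S); exact: cube_face_p.
by rewrite normal_cone_cube_face.
Qed.

End CubicalFan.

(** * Rank functions and the Bruhat order *)

Section Bruhat.

Local Open Scope nat_scope.

Variable n : nat.
Implicit Types (v w z : 'S_n) (i j m : 'I_n).

Definition inversions v : {set 'I_n * 'I_n} :=
  [set x : 'I_n * 'I_n | (x.1 < x.2) && (v x.2 < v x.1)].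

(* Inversions (a, b) of v are carried to (t a, t b) when this pair is still
   increasing, and kept otherwise; (i, j) is missed. *)
Lemma perm_length_tperm v i j : i < j -> v i < v j ->
  perm_length v < perm_length (perm_comp v (tperm i j)).
Proof.
move=> ij vij; set w := perm_comp _ _; set t := tperm i j.
have wE x : w x = v (t x) by rewrite /w permM.
pose f (x : 'I_n * 'I_n) := if t x.1 < t x.2 then (t x.1, t x.2) else x.
have f_inj : {in inversions v &, injective f}.
  move=> [a b] [c d]; rewrite !inE /f /= => /andP[ab _] /andP[cd _].
  case: ifP => tab; case: ifP => tcd //.
  - by case=> /perm_inj-> /perm_inj->.
  - by case=> ac bd; move: tcd; rewrite -ac -bd !tpermK ab.
  - by case=> ac bd; move: tab; rewrite ac bd !tpermK cd.
rewrite -[perm_length v]/(#|inversions v|) -(card_in_imset f_inj).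
apply: proper_card; apply/properP; split; last first.
  exists (i, j); first by rewrite inE /= ij !wE /t tpermL tpermR vij.
  apply/imsetP => -[[a b]]; rewrite [X in is_true X -> _]inE /f /= => /andP[ab vab].
  case: ifP => tab [ia jb]; last by subst a b; lia.
  have : t i < t j -> False by rewrite /t tpermL tpermR; lia.
  by apply; rewrite ia jb !tpermK.
apply/subsetP => _ /imsetP[[a b] + ->]; rewrite [X in is_true X -> _]inE /f /= => /andP[ab vab].
case: ifP => tab; first by rewrite inE /= !wE !tpermK tab.
rewrite inE /= ab !wE /=; move: tab; rewrite /t.
case: (tpermP i j a) => [?|?|/eqP ? /eqP ?]; case: (tpermP i j b) => [?|?|/eqP ? /eqP ?];
  subst; lia.
Qed.

Lemma bruhat_step_tperm v i j : i < j -> v i < v j ->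
  bruhat_step v (perm_comp v (tperm i j)).
Proof.
move=> ij vij; rewrite /bruhat_step perm_length_tperm // andbT.
by apply/existsP; exists (i, j).
Qed.

(** The length forces the direction of the swap: if it exchanged the values downwards, undoing it
    would lengthen [w] to [v]. *)
Lemma bruhat_stepP v w : bruhat_step v w ->
  exists i j, [/\ i < j, v i < v j & w = perm_comp v (tperm i j)].
Proof.
move=> /andP[/existsP[[i j] /= /eqP wE] vw].
wlog ij : i j wE / i < j.
  move=> H; case: (ltngtP i j) => [ij|ji|/val_inj ij]; first exact: (H i j).
    by apply: (H j i) => //; rewrite tpermC.
  by move: vw; rewrite wE ij tperm1 /perm_comp mul1g ltnn.
exists i, j; split=> //; rewrite ltnNge; apply/negP => vji.
have wji : w i < w j.
  rewrite wE !permM tpermL tpermR ltn_neqAle vji andbT.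
  by rewrite (inj_eq val_inj) (inj_eq perm_inj) neq_ltn ij orbT.
have := perm_length_tperm ij wji.
have -> : perm_comp w (tperm i j) = v by rewrite wE /perm_comp mulgA tperm2 mul1g.
by move: vw; lia.
Qed.

(** Monotonicity of this function along the Bruhat order is one half of the rank criterion for that
    order. *)
Definition rank v (p q : nat) := \sum_(i < n | i < p) (q <= v i).

Lemma rank_bruhat_step v w p q : bruhat_step v w -> rank v p q <= rank w p q.
Proof.
move=> /bruhat_stepP[i [j [ij vij ->]]]; rewrite /rank.
(* If both swapped positions lie before [p], the count is unchanged; otherwise only position [i] can
   matter, and its value grows. *)
have [jp|pj] := ltnP j p.
  rewrite (reindex_inj (@perm_inj _ (tperm i j))) /=.
  rewrite (eq_bigl (fun m : 'I_n => m < p)) /=.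
    by apply: leq_sum => m _; rewrite permM.
  by move=> m; case: tpermP => // ->; rewrite jp (ltn_trans ij).
apply: leq_sum => m mp; rewrite permM; case: tpermP => // mE.
  by rewrite mE; move: vij; lia.
by rewrite mE in mp; lia.
Qed.

Lemma rank_bruhat_le v w p q : bruhat_le v w -> rank v p q <= rank w p q.
Proof.
move=> /connectP[s]; elim: s v => [|z s IH] v /=; first by move=> _ ->.
move=> /andP[vz zs] wE; exact: leq_trans (rank_bruhat_step p q vz) (IH z zs wE).
Qed.

End Bruhat.

(** * One-line notation and window sums *)

Section OneLine.

Local Open Scope nat_scope.

Variable n : nat.
Implicit Types (v w z : 'S_n).

Lemma size_one_line z : size (one_line z) = n.
Proof. by rewrite size_map size_enum_ord. Qed.

Lemma nth_one_line z (i : 'I_n) : nth 0 (one_line z) i = z i.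
Proof. by rewrite (nth_map i) ?size_enum_ord // nth_ord_enum. Qed.

Lemma one_line_uniq z : uniq (one_line z).
Proof.
by rewrite map_inj_uniq ?enum_uniq // => i j /val_inj/perm_inj.
Qed.

Lemma one_line_inj : injective (@one_line n).
Proof.
by move=> v w E; apply/permP => i; apply: ord_inj; rewrite -!nth_one_line E.
Qed.

Lemma rankE z p q : p <= n ->
  rank z p q = \sum_(0 <= i < p) (q <= nth 0 (one_line z) i).
Proof.
move=> pn; rewrite big_mkord (big_ord_widen_cond _ predT
  (fun i => nat_of_bool (q <= nth 0 (one_line z) i)) pn).
by rewrite /rank; apply: eq_bigr => i _; rewrite nth_one_line.
Qed.

(* Layer-cake summation over the thresholds q: the rank inequalities bound the
   number of entries of z above q in the window by the number of entries of a
   above q in the window enlarged by one, and if [a m] is above q then the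
   trivial bound [r - l] is better by one. *)
Lemma interval_sum_le v w z (a := nth 0 (one_line v)) l r m :
    a 0 = 0 -> (forall j, nth 0 (one_line w) j = a j.+1) ->
    bruhat_le v z -> bruhat_le z w ->
    l <= m <= r -> r <= n -> (forall j, l <= j <= r -> a m <= a j) ->
  \sum_(l <= i < r) nth 0 (one_line z) i + a m <= \sum_(l <= j < r.+1) a j.
Proof.
move=> a0 wa vz zw lmr rn amin.
have layer (y : 'S_n) j :
    nth 0 (one_line y) j = \sum_(q < n) (q < nth 0 (one_line y) j).
  have : nth 0 (one_line y) j <= n.
    have [jn|nj] := ltnP j n; last by rewrite nth_default ?size_one_line.
    by rewrite (nth_one_line y (Ordinal jn)) ltnW.
  move: (nth _ _ _) => x xn.
  rewrite -[LHS]card_ord -sum1_card (eq_bigl predT) //.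
  rewrite (big_ord_widen_cond _ predT (fun=> 1) xn) big_mkcond /=.
  by apply: eq_bigr => i _; case: ifP.
have layers (y : 'S_n) s t : \sum_(s <= j < t) nth 0 (one_line y) j =
    \sum_(q < n) \sum_(s <= j < t) (q < nth 0 (one_line y) j).
  by rewrite exchange_big; apply: eq_bigr => j _; exact: layer.
have la := layer v; have lsa := layers v; rewrite -/a in la lsa.
rewrite (layers z) lsa (la m) -big_split /=; apply: leq_sum => q _.
set Zlr := \sum_(l <= i < r) _.
have lr : l <= r by lia.
have Zr := rank_bruhat_le r q.+1 zw.
have Zl := rank_bruhat_le l q.+1 vz.
rewrite !rankE -/a in Zr Zl; try lia.
rewrite (big_cat_nat (n := l)) //= -/Zlr in Zr.
have wE : \sum_(0 <= i < r) (q < nth 0 (one_line w) i) =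
    \sum_(0 <= i < r.+1) (q < a i).
  rewrite big_nat_recl // a0 add0n; apply: eq_bigr => i _; by rewrite wa.
rewrite wE [leqRHS](big_cat_nat (n := l)) //= in Zr; last by lia.
have [qm|qm] := ltnP q (a m); last by rewrite addn0; lia.
have -> : \sum_(l <= j < r.+1) (q < a j) = \sum_(l <= j < r.+1) 1.
  apply: eq_big_nat => j lj; have := amin j ltac:(lia).
  by move/(leq_trans qm) => ->.
have : Zlr <= \sum_(l <= j < r) 1 by apply: leq_sum => j _; case: (_ < _).
rewrite !sum_nat_const_nat; lia.
Qed.

End OneLine.

(** * Permutations obtained by filling an increasing tree *)

Section Fill.

Local Open Scope nat_scope.

Implicit Types (s t L : seq nat).

(** List form of chains of Bruhat steps. Lists can be cut at a tree node and concatenated again,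
    which the induction over the tree requires. *)
Inductive up_swaps : seq nat -> seq nat -> Prop :=
| up_refl s : up_swaps s s
| up_trans t s s' : up_swaps s t -> up_swaps t s' -> up_swaps s s'
| up_swap x y L1 L2 L3 : x < y ->
    up_swaps (L1 ++ x :: L2 ++ y :: L3) (L1 ++ y :: L2 ++ x :: L3).

Lemma up_swaps_cat s s' t t' : up_swaps s s' -> up_swaps t t' ->
  up_swaps (s ++ t) (s' ++ t').
Proof.
have ctx L L' x y : up_swaps x y -> up_swaps (L ++ x ++ L') (L ++ y ++ L').
  elim=> {x y} [x|x y z _ xy _|x y L1 L2 L3 xy].
  - exact: up_refl.
  - exact: up_trans.
  have assoc a b : L ++ (L1 ++ a :: L2 ++ b :: L3) ++ L' =
      (L ++ L1) ++ a :: L2 ++ b :: (L3 ++ L').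
    by rewrite -!catA /= -!catA.
  by rewrite !assoc; exact: up_swap.
move=> /(ctx [::] t) /= ss' /(ctx s' [::]); rewrite !cats0.
exact: up_trans.
Qed.

Lemma up_swaps_perm n (v : 'S_n) s : up_swaps (one_line v) s ->
  exists2 z, one_line z = s & bruhat_le v z.
Proof.
move E : (one_line v) => s0 us; elim: us v E => {s0 s}.
- by move=> s v <-; exists v => //; exact: connect0.
- move=> t s s' _ IH1 _ IH2 v /IH1[y yt vy]; have [z zs yz] := IH2 y yt.
  by exists z => //; exact: connect_trans yz.
move=> x y L1 L2 L3 xy v E.
have szE := size_one_line v; rewrite E !size_cat /= size_cat /= in szE.
have ilt : size L1 < n by lia.
have jlt : size L1 + (size L2).+1 < n by lia.
pose i := Ordinal ilt; pose j := Ordinal jlt.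
have vi : v i = x :> nat by rewrite -nth_one_line E nth_cat ltnn subnn.
have vj : v j = y :> nat.
  by rewrite -nth_one_line E nth_cat /= ltnNge leq_addr addKn /= nth_cat ltnn subnn.
exists (perm_comp v (tperm i j)); last first.
  by apply: connect1; apply: bruhat_step_tperm; rewrite ?vi ?vj //= ; lia.
apply: (@eq_from_nth _ 0).
  by rewrite size_one_line !size_cat /= size_cat /=; lia.
move=> k; rewrite size_one_line => kn; pose k' := Ordinal kn.
rewrite (nth_one_line _ k') permM; case: tpermP => [kE|kE|ki kj].
- have -> : k = size L1 by have := congr1 val kE.
  by rewrite vj nth_cat ltnn subnn.
- have -> : k = size L1 + (size L2).+1 by have := congr1 val kE.
  by rewrite vi nth_cat ltnNge leq_addr addKn /= nth_cat ltnn subnn.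
rewrite -nth_one_line E /= !nth_cat; case: ifP => // kL1.
have : k != size L1 by apply/eqP => kE; apply: ki; exact: val_inj.
have : k != size L1 + (size L2).+1 by apply/eqP => kE; apply: kj; exact: val_inj.
case kE : (k - size L1) => [|d] kj' ki'; first by lia.
rewrite /= !nth_cat; case: ifP => // dL2.
by case dE : (d - size L2) => [|e] //; lia.
Qed.

Definition min_entry s := nth 0 s (min_index s).

Lemma min_index_split s : s != [::] ->
  s = take (min_index s) s ++ min_entry s :: drop (min_index s).+1 s.
Proof.
case: s => // x s _; rewrite /min_entry -drop_nth ?cat_take_drop //.
exact: min_index_lt.
Qed.

Lemma min_entry_le s x : x \in s -> min_entry s <= x.
Proof.
case: s => // y s; rewrite /min_entry => xs.
have -> : nth 0 (y :: s) (min_index (y :: s)) = foldr minn y (y :: s).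
  by rewrite nth_index // -index_mem; exact: min_index_lt.
elim: (y :: s) xs => //= z t IH; rewrite inE geq_min => /orP[/eqP->|/IH->].
  by rewrite leqnn.
by rewrite orbT.
Qed.

Lemma min_entry_lt s : uniq s -> s != [::] ->
  all (ltn (min_entry s)) (take (min_index s) s) /\
  all (ltn (min_entry s)) (drop (min_index s).+1 s).
Proof.
move=> us s0; have sE := min_index_split s0.
have mem x : x \in take (min_index s) s \/ x \in drop (min_index s).+1 s -> x \in s.
  by case => [/mem_take|/mem_drop].
move: us; rewrite {1}sE cat_uniq /= => /and3P[_ + /andP[+ _]].
rewrite negb_or => /andP[mt _] md.
split; apply/allP => x xs /=; rewrite ltn_neqAle min_entry_le ?andbT;
  try by apply: mem; [left + right].
- by apply: contraNneq mt => ->.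
- by apply: contraNneq md => ->.
Qed.

(* The entries of s sit at the positions l + 1, l + 2, ..., and those of the
   result at l, l + 1, ... The set S of positions says in which subtree of a
   node the label of the node replaces the carried value h. *)
Fixpoint fill (S : pred nat) (m l h : nat) s : seq nat :=
  if m is m'.+1 then
    if s is [::] then [:: h] else
      let i := min_index s in
      if S (l + i).+1 then
        fill S m' l (min_entry s) (take i s) ++
        fill S m' (l + i).+1 h (drop i.+1 s)
      else
        fill S m' l h (take i s) ++
        fill S m' (l + i).+1 (min_entry s) (drop i.+1 s)
  else [:: h].

Lemma fillS S m l h s : s != [::] -> fill S m.+1 l h s =
  let i := min_index s in
  if S (l + i).+1 then
    fill S m l (min_entry s) (take i s) ++ fill S m (l + i).+1 h (drop i.+1 s)
  else
    fill S m l h (take i s) ++ fill S m (l + i).+1 (min_entry s) (drop i.+1 s).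
Proof. by case: s. Qed.

Lemma min_index_size s : s != [::] -> min_index s < size s.
Proof. by case: s => // x s _; exact: min_index_lt. Qed.

(** Gives the length of a filled block, and its sum independently of [S]. *)
Lemma perm_fill S m l h s : size s <= m -> perm_eq (fill S m l h s) (h :: s).
Proof.
elim: m l h s => [|m IH] l h s sm; first by case: s sm.
have [->//|s0] := eqVneq s [::].
have ilt := min_index_size s0.
have szt : size (take (min_index s) s) <= m by rewrite size_take ilt; lia.
have szd : size (drop (min_index s).+1 s) <= m by rewrite size_drop; lia.
rewrite fillS // /= [X in perm_eq _ (h :: X)](min_index_split s0).
case: ifP => _.
  apply: perm_trans (perm_cat (IH _ _ _ szt) (IH _ _ _ szd)) _.
  by apply/seq.permP => x; rewrite /= !count_cat /= ?count_cat /=; lia.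
apply: perm_trans (perm_cat (IH _ _ _ szt) (IH _ _ _ szd)) _.
by apply/seq.permP => x; rewrite /= !count_cat /= ?count_cat /=; lia.
Qed.

(** At each node the carried value and the label of the node are swapped once: before filling the
    two parts if the node is in [S], after filling them otherwise. The carried value is below every
    label, so the swap goes up. *)
Lemma fill_up_swaps S m l h s : size s <= m -> uniq s -> all (ltn h) s ->
  up_swaps (h :: s) (fill S m l h s) /\ up_swaps (fill S m l h s) (rcons s h).
Proof.
elim: m l h s => [|m IH] l h s sm us hs.
  by case: s sm us hs => // _ _ _; split; exact: up_refl.
have [->|s0] := eqVneq s [::]; first by split; exact: up_refl.
have ilt := min_index_size s0.
have szt : size (take (min_index s) s) <= m by rewrite size_take ilt; lia.
have szd : size (drop (min_index s).+1 s) <= m by rewrite size_drop; lia.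
have [mt md] := min_entry_lt us s0.
have sE := min_index_split s0.
rewrite fillS //= [X in h :: X]sE [X in rcons X]sE.
move: hs us; rewrite {1 2}sE all_cat cat_uniq /=.
move=> /and3P[ht hm hd] /and3P[ut _ /andP[_ ud]].
move: (take _ _) (drop _ _) (min_entry s) szt szd mt md ht hm hd ut ud.
move=> t d k szt szd mt md ht hm hd ut ud.
case: ifP => _.
- have [t1 t2] := IH l k t szt ut mt.
  have [d1 d2] := IH (l + min_index s).+1 h d szd ud hd.
  split.
    apply: up_trans (up_swaps_cat t1 d1).
    exact: (up_swap [::] t d hm).
  by apply: up_trans (up_swaps_cat t2 d2) _; rewrite cat_rcons rcons_cat rcons_cons; exact: up_refl.
- have [t1 t2] := IH l h t szt ut ht.
  have [d1 d2] := IH (l + min_index s).+1 k d szd ud md.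
  split; first exact: (up_swaps_cat t1 d1).
  apply: up_trans (up_swaps_cat t2 d2) _.
  rewrite cat_rcons rcons_cat rcons_cons -!cats1.
  exact: (up_swap t d [::] hm).
Qed.

End Fill.

(** * Triangulations dual to increasing trees *)

Section IncreasingTriangulation.

Local Open Scope nat_scope.

Variables (n : nat) (T : triangulation n) (a : nat -> nat).

(** Labels of the vertices strictly between [l] and [r], that is, of the nodes of the subtree below
    the distinguished edge [(l, r)]. *)
Definition slice l r := [seq a j | j <- index_iota l.+1 r].

Hypothesis a_bounds : forall j, 0 < j < n.+1 -> a 0 < a j /\ a n.+1 < a j.
Hypothesis a_uniq : uniq (slice 0 n.+1).
Hypothesis dual_treeE : dual_tree (val T) = increasing_tree n (slice 0 n.+1).

Lemma size_slice l r : size (slice l r) = r - l.+1.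
Proof. by rewrite size_map size_iota. Qed.

Lemma index_iota_cat l c r : l <= c <= r ->
  index_iota l r = index_iota l c ++ index_iota c r.
Proof.
move=> /andP[lc cr]; rewrite /index_iota -{2}(subnKC lc) -iotaD.
by congr iota; lia.
Qed.

Lemma slice_cat l c r : l < c < r -> slice l r = slice l c ++ a c :: slice c r.
Proof.
move=> lcr; rewrite /slice (@index_iota_cat _ c); last by lia.
rewrite map_cat {2}/index_iota.
have -> : r - c = (r - c.+1).+1 by lia.
by [].
Qed.

Lemma slice_uniq l r : r <= n.+1 -> uniq (slice l r).
Proof.
move=> rn; have [lr|lr] := leqP r l.+1.
  by rewrite /slice /index_iota (_ : r - l.+1 = 0) //; lia.
apply: subseq_uniq a_uniq; apply: map_subseq.
rewrite (@index_iota_cat 1 l.+1); last by lia.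
rewrite (@index_iota_cat l.+1 r n.+1); last by lia.
apply: subseq_trans (suffix_subseq _ _); exact: prefix_subseq.
Qed.

Lemma sumn_slice l r : sumn (slice l r) = \sum_(l.+1 <= j < r) a j.
Proof. by rewrite sumnE big_map. Qed.

Definition pushed (S : pred nat) := fill S n 0 0 (slice 0 n.+1).

Definition window S l r := [seq nth 0 (pushed S) i | i <- index_iota l r].

(** Invariant carried down through the distinguished edges: dual tree, increasing tree and [fill]
    stay in step with common fuel [m]. The value [h] is existential since it depends on the choices
    of [S] at the ancestors. *)
Record increasing_at (m : nat) (g : edge n) : Prop := IncreasingAt {
  at_lt : g.1 < g.2;
  at_full : full (val T) g.1 g.2;
  at_bounds : forall j, g.1 < j < g.2 -> a g.1 < a j /\ a g.2 < a j;
  at_size : g.2 - g.1 <= m.+1;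
  at_tree : dual_tree_rec (val T) m g = increasing_tree m (slice g.1 g.2);
  at_fill : forall S : pred nat, exists h : nat,
    window S g.1 g.2 = fill S m g.1 h (slice g.1 g.2) }.

Lemma increasing_at_base : increasing_at n (base_edge n).
Proof.
split=> //; first exact: triangulation_full (valP T).
move=> S; exists 0; rewrite /window /= -/(pushed S).
have size_pushed : size (pushed S) = n.+1.
  by rewrite (perm_size (perm_fill _ _ _ _)) /= size_slice subn1.
by have := mkseq_nth 0 (pushed S); rewrite size_pushed.
Qed.

(** The apex is the position of the least label of the slice. One of the two sub-windows then starts
    from the known value [a c], and the other continues with the carried one. *)
Lemma increasing_at_apex m l r (c : 'I_n.+2) :
    increasing_at m (l, r) -> apex (val T) (l, r) = Some c ->
  exists m', [/\ increasing_at m' (l, c), increasing_at m' (c, r),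
    l < c < r,
    forall j, l < j < r -> a c <= a j &
    forall S : pred nat,
      (S c -> window S l c = fill S m' l (a c) (slice l c)) /\
      (~~ S c -> window S c r = fill S m' c (a c) (slice c r))].
Proof.
case=> /= lr fT ab sm treeE Sh apE.
have pT := triangulation_planar (valP T).
have [/= lc cr _ _] := apexP apE.
case: m sm treeE Sh => [|m] sm; first by lia.
have lrS : l.+1 < r by lia.
have [c' [_ _ apE' [flc fcr] _]] := full_split pT lrS fT.
move: apE'; rewrite apE => -[?]; subst c'.
set s := slice l r => treeE Sh.
have rn : r <= n.+1 by rewrite -ltnS.
have us : uniq s by exact: slice_uniq.
have szs : size s = r - l.+1 by exact: size_slice.
have s0 : s != [::] by rewrite -size_eq0 szs; lia.
have ilt := min_index_size s0.
move: treeE; rewrite /= apE; case sE : s s0 => [//|x s'] s0; rewrite -sE in s0 *.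
case=> treeL treeR.
have sizeT : size (take (min_index s) s) = min_index s by rewrite size_take ilt.
have clm : c - l <= m.+1 by lia.
(* The size of the left subtree, computed from the polygon and from the list, places the minimum of
   the slice at [c]. *)
have [cE _] := full_dual_tree pT lc flc clm.
move: cE; rewrite treeL nodes_increasing_tree sizeT; last by lia.
move=> cE.
have ic : min_index s = c - l.+1 by lia.
have sc : s = slice l c ++ a c :: slice c r by apply: slice_cat; rewrite lc cr.
have szl : size (slice l c) = min_index s by rewrite size_slice ic.
have tE : take (min_index s) s = slice l c by rewrite -szl sc take_size_cat.
have dE : drop (min_index s).+1 s = slice c r.
  by rewrite -szl sc -cat_rcons drop_size_cat // size_rcons.
have mE : min_entry s = a c by rewrite /min_entry -szl sc nth_cat ltnn subnn.
have [mt md] := min_entry_lt us s0; rewrite tE mE in mt; rewrite dE mE in md.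
rewrite tE in treeL; rewrite dE in treeR.
have memS l' r' j : l' < j < r' -> a j \in slice l' r'.
  by move=> ?; apply: map_f; rewrite mem_index_iota.
have fillE (S : pred nat) h : fill S m.+1 l h s =
    if S c then fill S m l (a c) (slice l c) ++ fill S m c h (slice c r)
    else fill S m l h (slice l c) ++ fill S m c (a c) (slice c r).
  have cS : (l + min_index s).+1 = c by lia.
  by rewrite fillS //= cS tE dE mE.
(* [fill] on the left slice has length [c - l], so the equality of concatenations splits at [c]. *)
have winE (S : pred nat) h h' : window S l r = fill S m l h (slice l c) ++ fill S m c h' (slice c r) ->
    window S l c = fill S m l h (slice l c) /\
    window S c r = fill S m c h' (slice c r).
  rewrite /window (@index_iota_cat l c); last by lia.
  have fit : size (slice l c) <= m by rewrite size_slice; lia.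
  rewrite map_cat => /eqP; rewrite eqseq_cat; last first.
    by rewrite size_map size_iota (perm_size (perm_fill _ _ _ fit)) /= size_slice; lia.
  by move=> /andP[/eqP-> /eqP->].
have windows (S : pred nat) : exists h : nat, if S c then
      window S l c = fill S m l (a c) (slice l c) /\
      window S c r = fill S m c h (slice c r)
    else window S l c = fill S m l h (slice l c) /\
      window S c r = fill S m c (a c) (slice c r).
  have [h hE] := Sh S; exists h; rewrite fillE in hE.
  by case: (S c) hE => /winE.
exists m; split.
- split=> //=; first move=> j lj.
    split; first by apply: (ab j _).1; lia.
    by apply: (allP mt); exact: memS.
  move=> S; have [h] := windows S.
  by case: (S c) => -[-> _]; [exists (a c) | exists h].
- split=> //=; first move=> j lj.
  + split; last by apply: (ab j _).2; lia.
    by apply: (allP md); exact: memS.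
  + by lia.
  move=> S; have [h] := windows S.
  by case: (S c) => -[_ ->]; [exists h | exists (a c)].
- by rewrite lc cr.
- by move=> j lj; rewrite -mE; apply: min_entry_le; exact: memS.
- by move=> S; have [h] := windows S; case: (S c) => -[].
Qed.

Lemma distinguished_increasing g : distinguished (val T) g ->
  exists m, increasing_at m g.
Proof.
elim=> [|[l r] c _ [m gm] apE|[l r] c _ [m gm] apE].
- by exists n; exact: increasing_at_base.
- by have [m' []] := increasing_at_apex gm apE; exists m'.
- by have [m' []] := increasing_at_apex gm apE; exists m'.
Qed.

Lemma sumn_window S l r :
  sumn (window S l r) = \sum_(l <= i < r) nth 0 (pushed S) i.
Proof. by rewrite sumnE big_map. Qed.

(** By uniqueness of neighbours, [(l, r)] is the distinguished edge with apex [k]. The block that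
    received [a k] is a rearrangement of [a k] and the adjacent slice, whence its sum. *)
Lemma nbs_increasing (k : 'I_n.+2) (l := left_nb (val T) k)
    (r := right_nb (val T) k) : 0 < k <= n ->
  [/\ l < k < r, a l < a k /\ a r < a k,
      forall j, l < j < r -> a k <= a j &
      forall S : pred nat,
        if S k then \sum_(l <= i < k) nth 0 (pushed S) i = \sum_(l.+1 <= j < k.+1) a j
        else \sum_(k <= i < r) nth 0 (pushed S) i = \sum_(k <= j < r) a j].
Proof.
move=> kn; have [[l' r'] dg apE] := distinguished_apex T kn.
have [/= lk kr _ _] := apexP apE.
have lE : l' = l by apply/left_nbP => //; split=> //; exact: (F_fL dg apE).
have rE : r' = r by apply/right_nbP => //; split=> //; exact: (F_fR dg apE).
subst l' r'; have [m gm] := distinguished_increasing dg.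
have [m' [gl gr lkr kmin wS]] := increasing_at_apex gm apE.
split=> //; first by apply: (at_bounds gm); rewrite lk.
move=> S; have [SL SR] := wS S.
case: ifP => Sk.
  rewrite -sumn_window SL // (perm_sumn (perm_fill _ _ _ _)) /=; last first.
    by rewrite size_slice; have /= := at_size gl; lia.
  by rewrite sumn_slice big_nat_recr //= addnC.
rewrite -sumn_window SR ?Sk // (perm_sumn (perm_fill _ _ _ _)) /=; last first.
  by rewrite size_slice; have /= := at_size gr; lia.
by rewrite sumn_slice [RHS]big_ltn.
Qed.

End IncreasingTriangulation.

(** * The interval from perm_h u *)

Section PsiU.

Local Open Scope nat_scope.

Lemma min_index_succ s : min_index (map S s) = min_index s.
Proof.
case: s => // x s; rewrite /min_index.
have -> : foldr minn (head 0 (map S (x :: s))) (map S (x :: s)) =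
    (foldr minn (head 0 (x :: s)) (x :: s)).+1.
  by rewrite /= -minnSS; congr minn; elim: s => //= y s ->; rewrite minnSS.
exact: index_map succn_inj _ _.
Qed.

(** Only the relative order of labels enters, so the shift of values made by [perm_h] is
    harmless. *)
Lemma increasing_tree_succ m s : increasing_tree m (map S s) = increasing_tree m s.
Proof.
elim: m s => [|m IH] s //; have [->//|s0] := eqVneq s [::].
have stepE t : t != [::] -> increasing_tree m.+1 t =
    Node (increasing_tree m (take (min_index t) t))
         (increasing_tree m (drop (min_index t).+1 t)) by case: t.
rewrite !stepE //; last by rewrite -size_eq0 size_map size_eq0.
by rewrite min_index_succ -map_take -map_drop !IH.
Qed.

Variables (n : nat) (u : 'S_n).

Definition shifted := map S (one_line u).

Lemma size_shifted : size shifted = n.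
Proof. by rewrite size_map size_one_line. Qed.

Lemma one_line_perm_h : one_line (perm_h u) = 0 :: shifted.
Proof.
apply: (@eq_from_nth _ 0); rewrite ?size_one_line /= ?size_shifted // => i ilt.
rewrite (nth_one_line _ (Ordinal ilt)) /perm_h.
case: (unliftP ord0 (Ordinal ilt)) => [j|] iE; have /= iE' := congr1 val iE; last first.
  by rewrite iE lift_perm_id iE'.
rewrite iE lift_perm_lift iE' /= /bump leq0n add1n add0n /=.
by rewrite /shifted (nth_map 0 _ S) ?size_one_line // nth_one_line.
Qed.

Lemma s1nE (i : 'I_n.+1) : s1n n i = (if i == n :> nat then 0 else i.+1) :> nat.
Proof.
pose F j : 'S_n.+1 := tperm (inord j) (inord j.+1).
have -> : s1n n = \big[@perm_comp n.+1/1%g]_(0 <= j < n) F j.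
  rewrite /s1n big_mkord; apply: eq_bigr => j _; congr tperm; apply: val_inj.
    by rewrite /= inordK // ltnS ltnW.
  by rewrite /= inordK // ltnS.
(* Generalized to the product of the factors from [m] on, which fixes everything below [m] and
   cycles m, ..., n. *)
suff H d m (x : 'I_n.+1) : m + d = n ->
    (\big[@perm_comp n.+1/1%g]_(m <= j < n) F j) x =
    (if x < m then x : nat else if x == n :> nat then m else x.+1) :> nat.
  by rewrite (H n 0).
elim: d m x => [|d IH] m x mn.
  rewrite big_geq ?perm1; last by lia.
  by have xn := ltn_ord x; do ?[case: ltnP => ?|case: eqP => ?]; lia.
rewrite big_ltn; last by lia.
rewrite permM.
have := IH m.+1 x ltac:(lia).
move: (X in X x) => g gx; rewrite /F.
have mV : (inord m : 'I_n.+1) = m :> nat by rewrite inordK; lia.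
have mV' : (inord m.+1 : 'I_n.+1) = m.+1 :> nat by rewrite inordK; lia.
have xn := ltn_ord x.
case: tpermP => [gE|gE|/eqP gE /eqP gE'].
- by move: gx; rewrite gE mV mV'; do ?[case: ltnP => ?|case: eqP => ?]; lia.
- by move: gx; rewrite gE mV mV'; do ?[case: ltnP => ?|case: eqP => ?]; lia.
rewrite -val_eqE /= mV in gE; rewrite -val_eqE /= mV' in gE'.
by move: gx gE gE'; do ?[case: ltnP => ?|case: eqP => ?]; lia.
Qed.

Definition upper := perm_comp (perm_h u) (s1n n).

Lemma one_line_upper : one_line upper = rcons shifted 0.
Proof.
apply: (@eq_from_nth _ 0); rewrite ?size_rcons ?size_one_line ?size_shifted //.
move=> i ilt; rewrite (nth_one_line _ (Ordinal ilt)) permM -nth_one_line.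
rewrite one_line_perm_h s1nE /= nth_rcons size_shifted.
by move: ilt; rewrite ltnS; case: (ltngtP i n).
Qed.

(** The sequence a. The default 0 of [nth] supplies a(n+1) = 0, so multiplication by s(1,n) becomes
    a shift of a by one. *)
Definition entry := nth 0 (one_line (perm_h u)).

Lemma entry0 : entry 0 = 0.
Proof. by rewrite /entry one_line_perm_h. Qed.

Lemma entry_last : entry n.+1 = 0.
Proof. by rewrite /entry nth_default // size_one_line. Qed.

Lemma entry_gt0 j : 0 < j < n.+1 -> 0 < entry j.
Proof.
case: j => // j; rewrite ltnS => jn; rewrite /entry one_line_perm_h /=.
by rewrite /shifted (nth_map 0 _ S) ?size_one_line.
Qed.

Lemma entry_upper j : nth 0 (one_line upper) j = entry j.+1.
Proof.
rewrite one_line_upper /entry one_line_perm_h /= nth_rcons.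
case: ltngtP => // [jn|->]; first by rewrite nth_default // ltnW.
by rewrite nth_default.
Qed.

Lemma slice_entry : slice entry 0 n.+1 = shifted.
Proof.
rewrite /slice /index_iota subn1 /= -[X in iota X]addn0 iotaDl -map_comp.
rewrite /entry one_line_perm_h -[RHS](mkseq_nth 0) size_shifted.
exact: eq_map.
Qed.

Lemma dual_tree_psi : dual_tree (val (psi u)) = increasing_tree n (slice entry 0 n.+1).
Proof.
rewrite slice_entry increasing_tree_succ.
rewrite /psi; set B := exist _ _ _.
exact: (congr1 sval (triangulation_of_treeK B)).
Qed.

Lemma entry_bounds j : 0 < j < n.+1 -> entry 0 < entry j /\ entry n.+1 < entry j.
Proof. by move=> /entry_gt0 j0; rewrite entry0 entry_last. Qed.

Lemma slice_entry_uniq : uniq (slice entry 0 n.+1).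
Proof.
rewrite slice_entry (map_inj_uniq succn_inj); exact: one_line_uniq.
Qed.

(** Carrying 0 through the tree starts from [0 :: shifted], the lower endpoint, and stays below
    [rcons shifted 0], the upper one. *)
Lemma vertex_exists (S : pred nat) : exists z : 'S_n.+1,
  [/\ one_line z = pushed n entry S, bruhat_le (perm_h u) z & bruhat_le z upper].
Proof.
have sz : size (slice entry 0 n.+1) <= n by rewrite size_slice subn1.
have pos : all (ltn 0) (slice entry 0 n.+1).
  by rewrite slice_entry; apply/allP => _ /mapP[x _ ->].
have [up1 up2] := fill_up_swaps S 0 sz slice_entry_uniq pos.
move: up1 up2; rewrite -/(pushed _ _ _) {1}slice_entry -one_line_perm_h.
move=> /up_swaps_perm[z zE vz]; rewrite -zE slice_entry -one_line_upper.
by move=> /up_swaps_perm[w /one_line_inj <- zw]; exists z.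
Qed.

Lemma window_le z l r m : bruhat_le (perm_h u) z -> bruhat_le z upper ->
    l <= m <= r -> r <= n.+1 -> (forall j, l <= j <= r -> entry m <= entry j) ->
  \sum_(l <= i < r) nth 0 (one_line z) i + entry m <= \sum_(l <= j < r.+1) entry j.
Proof. by apply: interval_sum_le; [exact: entry0 | exact: entry_upper]. Qed.

End PsiU.

(** * Fundamental weights and convex hulls *)

Section Span.

Local Open Scope ring_scope.

Variables (R : realType) (n : nat).

Lemma varpi0 : varpi R ord0 = 0 :> NR R n.
Proof. by rewrite /varpi big_pred0 ?raddf0. Qed.

Lemma varpi_max : varpi R ord_max = 0 :> NR R n.
Proof.
apply/eqP; rewrite -(raddf0 (@NR_proj R n)) NR_projE subr0.
rewrite (_ : \sum_(k < n.+1 | _) _ = const_mx 1) ?inE /ones_line //; first exact: submx_refl.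
apply/rowP => j; rewrite summxE (bigD1 j) //= big1 ?addr0 ?mxE ?eqxx //.
by move=> i /andP[_ ij]; rewrite !mxE eqxx eq_sym (negbTE ij).
Qed.

(** Phrased as an induction principle; basis vectors are differences of consecutive fundamental
    weights. *)
Lemma varpi_span (Sp : NR R n -> Prop) : Sp 0 ->
  (forall x y, Sp x -> Sp y -> Sp (x + y)) -> (forall a x, Sp x -> Sp (a *: x)) ->
  (forall i, Sp (varpi R i)) -> forall x, Sp x.
Proof.
move=> Sp0 SpD SpZ Spv x; rewrite -[x]NR_reprK; move: (generic_quotient.repr x) => X.
rewrite (row_sum_delta X) linear_sum; apply: (big_ind Sp) => // i _; rewrite linearZ /=.
apply: (SpZ); have -> : NR_proj (delta_mx 0 i) =
    varpi R (lift ord0 i) - varpi R (widen_ord (leqnSn _) i).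
  rewrite /varpi -raddfB; congr NR_proj.
  rewrite (bigD1 i) /=; last by rewrite /bump leq0n add1n.
  rewrite (eq_bigl (fun k : 'I_n.+1 => (k < i)%N)) ?addrK // => k.
  by rewrite /bump leq0n add1n ltnS ltn_neqAle andbC.
by rewrite -scaleN1r; apply: SpD => //; exact: SpZ.
Qed.

Lemma varpi_pairing i m : sum_zero m ->
  NR_pairing (varpi R i) m = \sum_(k < n.+1 | (k < i)%N) m 0 k.
Proof.
move=> m0; rewrite NR_pairing_proj // /dot [RHS]big_mkcond; apply: eq_bigr => j _.
rewrite summxE (eq_bigr (fun k : 'I_n.+1 => (k == j)%:R)); last first.
  by move=> k _; rewrite !mxE eqxx eq_sym.
case: ifP => ji; last first.
  rewrite big1 ?mul0r // => k ki; case: eqP => // kj; by rewrite kj ji in ki.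
rewrite (bigD1 j) //= eqxx big1 ?addr0 ?mul1r // => k /andP[_ /negbTE ->] //.
Qed.

Lemma hull_dot_ge (A : set 'rV[R]_n.+1) C b : (forall y, A y -> b <= dot C y) ->
  forall y, convex_hull A y -> b <= dot C y.
Proof.
move=> Ab y; apply: (@smallest_sub _ _ _ [set y | b <= dot C y]%classic) => //.
move=> {}y z t /set_mem /= yb /set_mem /= zb; apply/mem_set => /=.
rewrite -[conv t y z]/(t%:num *: (y : 'rV[R]_n.+1) + (1 - t%:num) *: z).
have -> : dot C (t%:num *: (y : 'rV[R]_n.+1) + (1 - t%:num) *: z) =
    t%:num * dot C y + (1 - t%:num) * dot C z.
  rewrite /dot !mulr_sumr -big_split; apply: eq_bigr => i _ /=.
  by rewrite !mxE mulrDr !(mulrCA (C 0 i)).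
have -> : b = t%:num * b + (1 - t%:num) * b by rewrite -mulrDl addrC subrK mul1r.
by apply: lerD; apply: ler_wpM2l; rewrite ?subr_ge0 ?ge0 ?le1.
Qed.

Lemma hull_dot_eq (A : set 'rV[R]_n.+1) C b : (forall y, A y -> dot C y = b) ->
  forall y, convex_hull A y -> dot C y = b.
Proof.
move=> Ab y hy; apply: le_anti; rewrite andbC (hull_dot_ge _ hy) /=; last first.
  by move=> z /Ab ->.
rewrite -lerN2 -(mulN1r (dot C y)) -dotZl (hull_dot_ge _ hy) // => z /Ab zb.
by rewrite dotZl mulN1r zb.
Qed.

End Span.

(** * The normal fan *)

Section Main.

Local Open Scope ring_scope.

Variables (R : realType) (n : nat) (u : 'S_n).

Let T := psi u.
Let P := @bruhat_polytope R n (perm_h u) (upper u).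

Definition inner : pred 'I_n.+2 := fun k => (0 < k <= n)%N.

Definition label_pred (S : {set 'I_n.+2}) : pred nat := fun j => inord j \in S.

Lemma label_predE (S : {set 'I_n.+2}) (k : 'I_n.+2) : label_pred S k = (k \in S).
Proof. by rewrite /label_pred inord_val. Qed.

Definition vertex (S : {set 'I_n.+2}) : 'S_n.+1 :=
  projT1 (cid (vertex_exists u (label_pred S))).

Lemma one_line_vertex S : one_line (vertex S) = pushed n (entry u) (label_pred S).
Proof. by rewrite /vertex; case: cid => z []. Qed.

Definition in_interval (z : 'S_n.+1) :=
  bruhat_le (perm_h u) z && bruhat_le z (upper u).

Lemma vertex_in_interval S : in_interval (vertex S).
Proof. by rewrite /vertex; case: cid => z /= [_ vz zw]; apply/andP. Qed.

Lemma P_perm_point z : in_interval z -> P (perm_point R z).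
Proof. by move=> zi; apply: sub_gen_smallest; exists z. Qed.

Lemma sum_perm_point z :
  \sum_(i < n.+1) (perm_point R z) 0 i = \sum_(i < n.+1) i.+1%:R.
Proof.
rewrite [RHS](reindex_inj (@perm_inj _ z)) /=.
by apply: eq_bigr => i _; rewrite mxE.
Qed.

Lemma P_sum_zero y z : P y -> P z -> sum_zero (y - z).
Proof.
have dot1 x : dot (const_mx 1) x = \sum_(i < n.+1) x 0 i :> R.
  by apply: eq_bigr => i _; rewrite mxE mul1r.
have sumP x : P x -> \sum_(i < n.+1) x 0 i = \sum_(i < n.+1) i.+1%:R.
  by rewrite -dot1; apply: hull_dot_eq => _ [z' _ <-]; rewrite dot1 sum_perm_point.
move=> /sumP yE /sumP zE; rewrite /sum_zero.
rewrite (eq_bigr (fun i => y 0 i - z 0 i)); last by move=> i _; rewrite !mxE.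
by rewrite sumrB yE zE subrr.
Qed.

Lemma P_pairing_ge0 x y S :
  (forall z, in_interval z ->
    0 <= NR_pairing x (perm_point R z - perm_point R (vertex S))) ->
  P y -> 0 <= NR_pairing x (y - perm_point R (vertex S)).
Proof.
move=> H Py; have Pv := P_perm_point (vertex_in_interval S).
rewrite -[x]NR_reprK (dot_pairing P_sum_zero) // subr_ge0.
apply: (hull_dot_ge _ Py) => _ [z /= zi <-].
rewrite -subr_ge0 -(dot_pairing P_sum_zero) ?NR_reprK //; first exact: H.
exact: P_perm_point.
Qed.

(** * Partial sums and the facet inequalities *)

Definition psum (z : 'S_n.+1) l r : nat := \sum_(l <= i < r) nth 0%N (one_line z) i.

Lemma psum_cat z l c r : (l <= c <= r)%N -> psum z l r = (psum z l c + psum z c r)%N.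
Proof. by move=> /andP[lc cr]; rewrite /psum (big_cat_nat lc cr). Qed.

Lemma varpi_pairing_perm i z z' : in_interval z -> in_interval z' ->
  NR_pairing (varpi R i) (perm_point R z - perm_point R z') =
  (psum z 0 i)%:R - (psum z' 0 i)%:R.
Proof.
move=> zi zi'; rewrite varpi_pairing; last by apply: P_sum_zero; exact: P_perm_point.
have psumE y : (psum y 0 i)%:R = \sum_(k < n.+1 | (k < i)%N) (y k)%:R :> R.
  rewrite /psum big_mkord natr_sum.
  rewrite (big_ord_widen_cond n.+1 predT (fun k => (nth 0%N (one_line y) k)%:R)) //.
    by apply: eq_bigr => k _; rewrite nth_one_line.
  by rewrite -ltnS.
rewrite !psumE -sumrB; apply: eq_bigr => k _.
(* [perm_point] uses values from 1 and [psum] values from 0; the shift cancels in the difference. *)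
by rewrite !mxE -!natr1 opprD addrACA subrr addr0.
Qed.

(** [ray_v] is represented by minus the indicator vector of the window [k, k_R), so its pairing is
    least where the window sum is greatest. *)
Lemma ray_v_pairing k z z' : inner k -> in_interval z -> in_interval z' ->
  let r := right_nb (val T) k in
  NR_pairing (ray_v R T k) (perm_point R z - perm_point R z') =
  (psum z' k r)%:R - (psum z k r)%:R.
Proof.
move=> Dk zi zi' r; have [/andP[lk kr] _ _ _] := nbs_increasing
  (@entry_bounds _ u) (@slice_entry_uniq _ u) (dual_tree_psi u) Dk.
have m0 : sum_zero (perm_point R z - perm_point R z').
  by apply: P_sum_zero; exact: P_perm_point.
rewrite /ray_v pairingD // pairingN // !varpi_pairing_perm //.
rewrite -/r (@psum_cat z 0 k r) 1?(@psum_cat z' 0 k r) ?natrD; first ring.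
all: by rewrite /= ltnW.
Qed.

Lemma ray_w_pairing k z z' : inner k -> in_interval z -> in_interval z' ->
  let l := left_nb (val T) k in
  NR_pairing (ray_w R T k) (perm_point R z - perm_point R z') =
  (psum z' l k)%:R - (psum z l k)%:R.
Proof.
move=> Dk zi zi' l; have [/andP[lk kr] _ _ _] := nbs_increasing
  (@entry_bounds _ u) (@slice_entry_uniq _ u) (dual_tree_psi u) Dk.
have m0 : sum_zero (perm_point R z - perm_point R z').
  by apply: P_sum_zero; exact: P_perm_point.
rewrite /ray_w pairingD // pairingN // !varpi_pairing_perm //.
rewrite -/l (@psum_cat z 0 l k) 1?(@psum_cat z' 0 l k) ?natrD; first ring.
all: by rewrite /= ltnW.
Qed.

(** The bounds for the windows [[l, k)] and [[k, r)] are attained at the vertices with [k] in,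
    respectively not in, [S]; the window [[l, r)] shows that they are never attained together. *)
Lemma inner_facts k (l := left_nb (val T) k) (r := right_nb (val T) k)
    (a := entry u) : inner k ->
  [/\ (l < k < r)%N, (a l < a k)%N /\ (a r < a k)%N,
    forall (S : {set 'I_n.+2}) z, in_interval z ->
      if k \in S then (psum z l k <= psum (vertex S) l k)%N
      else (psum z k r <= psum (vertex S) k r)%N &
    forall S S' : {set 'I_n.+2}, k \in S -> k \notin S' ->
      (psum (vertex S') l k < psum (vertex S) l k)%N /\
      (psum (vertex S) k r < psum (vertex S') k r)%N].
Proof.
move=> Dk; have [lkr [al ar] amin aS] := nbs_increasing
  (@entry_bounds _ u) (@slice_entry_uniq _ u) (dual_tree_psi u) Dk.
rewrite -/l -/r -/T -/a in lkr al ar amin aS.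
have rn : (r <= n.+1)%N by rewrite -ltnS.
have aSum (S : {set 'I_n.+2}) : if k \in S then psum (vertex S) l k = (\sum_(l.+1 <= j < k.+1) a j)%N
    else psum (vertex S) k r = (\sum_(k <= j < r) a j)%N.
  by have := aS (label_pred S); rewrite label_predE /psum one_line_vertex.
have amin' j : (l <= j <= r)%N -> j = l \/ j = r \/ (a k <= a j)%N.
  move=> lj; have [->|jl] := eqVneq j l; first by left.
  have [->|jr] := eqVneq j r; first by right; left.
  by right; right; apply: amin; lia.
have le_window z s t m : in_interval z -> (l <= s)%N -> (t <= r)%N -> (s <= m <= t)%N ->
    (forall j, (s <= j <= t)%N -> (a m <= a j)%N) ->
    (psum z s t + a m <= \sum_(s <= j < t.+1) a j)%N.
  move=> /andP[vz zw] ls tr smt am; apply: window_le => //; lia.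
(* The smallest entry is [a l] on [[l, k]] and [a r] on [[k, r]]; cancelling it drops one term of
   the sum. *)
have leL z : in_interval z -> (psum z l k <= \sum_(l.+1 <= j < k.+1) a j)%N.
  move=> zi; have : (psum z l k + a l <= \sum_(l <= j < k.+1) a j)%N.
    apply: le_window => //; try lia.
    by move=> j lj; have [||] := amin' j; [lia|move=> ->|case=> [jE|]; lia].
  by rewrite big_ltn; lia.
have leR z : in_interval z -> (psum z k r <= \sum_(k <= j < r) a j)%N.
  move=> zi; have : (psum z k r + a r <= \sum_(k <= j < r.+1) a j)%N.
    apply: le_window => //; try lia.
    by move=> j lj; have [||] := amin' j; [lia|move=> jE; lia|case=> [->|]; lia].
  by rewrite big_nat_recr /=; lia.
(* The bound for [[l, r)] is the sum of the two others plus max (a l, a r) - a k, which is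
   negative. *)
have leW z : in_interval z -> (psum z l k + psum z k r <
    \sum_(l.+1 <= j < k.+1) a j + \sum_(k <= j < r) a j)%N.
  move=> zi; rewrite -psum_cat; last by lia.
  have sumE : (\sum_(l <= j < r.+1) a j + a k = a l + a r +
      (\sum_(l.+1 <= j < k.+1) a j + \sum_(k <= j < r) a j))%N.
    rewrite big_ltn; last by lia.
    rewrite (@big_cat_nat _ _ _ k.+1) /=; [|lia|lia].
    rewrite (@big_nat_recr _ _ _ r k.+1) /=; last by lia.
    rewrite [in RHS](@big_ltn _ _ _ k r); last by lia.
    by lia.
  have [alr|arl] := leqP (a l) (a r).
    have : (psum z l r + a l <= \sum_(l <= j < r.+1) a j)%N.
      apply: le_window => //; try lia.
      by move=> j /amin'[->|[->|]]; lia.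
    by lia.
  have : (psum z l r + a r <= \sum_(l <= j < r.+1) a j)%N.
    apply: le_window => //; try lia.
    by move=> j /amin'[->|[->|]]; lia.
  by lia.
split=> // [S z zi|S S' kS kS'].
  have := aSum S; case: ifP => _ ->; [exact: leL | exact: leR].
have := aSum S; have := aSum S'; rewrite kS (negbTE kS') => E' E.
have := leW _ (vertex_in_interval S); have := leW _ (vertex_in_interval S'); lia.
Qed.

Lemma vertex_ray_ge0 S k y : inner k -> P y ->
  0 <= NR_pairing (ray (ray_v R T) (ray_w R T) S k) (y - perm_point R (vertex S)).
Proof.
move=> Dk; apply: P_pairing_ge0 => z zi; have [_ _ + _] := inner_facts Dk.
move=> /(_ S z zi); rewrite /ray; have Sv := vertex_in_interval S.
by case: ifP => _; rewrite ?ray_w_pairing ?ray_v_pairing // subr_ge0 ler_nat.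
Qed.

Lemma vertex_ray_gt0 (S S' : {set 'I_n.+2}) k : inner k -> (k \in S) != (k \in S') ->
  0 < NR_pairing (ray (ray_v R T) (ray_w R T) S k)
        (perm_point R (vertex S') - perm_point R (vertex S)).
Proof.
move=> Dk; have Sv := vertex_in_interval S; have Sv' := vertex_in_interval S'.
have [_ _ _ lt] := inner_facts Dk; rewrite /ray.
case: ifP => kS; case: (boolP (k \in S')) => kS' // _.
  by rewrite ray_w_pairing // subr_gt0 ltr_nat; have [] := lt _ _ kS kS'.
by rewrite ray_v_pairing // subr_gt0 ltr_nat; have [] := lt _ _ kS' (negbT kS).
Qed.

(** Triangularity: whichever ray is chosen at [i], it expresses [varpi] at [i] through [varpi] at a
    neighbour with smaller entry. Induction on the entry ends at 0 and n+1, where [varpi]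
    vanishes. *)
Lemma vertex_ray_span S x : exists c : 'I_n.+2 -> R,
  x = \sum_(k | inner k) c k *: ray (ray_v R T) (ray_w R T) S k.
Proof.
pose q := ray (ray_v R T) (ray_w R T) S.
pose Sp x := exists c : 'I_n.+2 -> R, x = \sum_(k | inner k) c k *: q k.
have Sp0 : Sp 0.
  by exists (fun=> 0); rewrite big1 // => k _; rewrite scale0r.
have SpD y z : Sp y -> Sp z -> Sp (y + z).
  move=> [c ->] [d ->]; exists (fun k => c k + d k).
  by rewrite -big_split; apply: eq_bigr => k _; rewrite scalerDl.
have SpZ a y : Sp y -> Sp (a *: y).
  move=> [c ->]; exists (fun k => a * c k).
  by rewrite scaler_sumr; apply: eq_bigr => k _; rewrite scalerA.
have Spq k : inner k -> Sp (q k).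
  move=> Dk; exists (fun j => (j == k)%:R).
  rewrite (bigD1 k) //= eqxx scale1r big1 ?addr0 // => j /andP[_ /negbTE ->].
  by rewrite scale0r.
rewrite -/(Sp x); apply: (varpi_span Sp0 SpD SpZ) => i.
have [m] := ubnP (entry u i); elim: m i => // m IH i im.
have [Di|] := boolP (inner i); last first.
  rewrite /inner negb_and -leqNgt leqn0 -ltnNge => /orP[/eqP i0|ni].
    by have -> : i = ord0 by [apply: val_inj]; rewrite varpi0.
  have -> : i = ord_max by apply: val_inj => /=; have := ltn_ord i; lia.
  by rewrite varpi_max.
have [_ [al ar] _ _] := inner_facts Di.
have := Spq i Di; rewrite /q /ray; case: ifP => _ Sq.
  have -> : varpi R i = varpi R (left_nb (val T) i) + (-1) *: ray_w R T i.
    by rewrite scaleN1r /ray_w opprB addrC subrK.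
  by apply: (SpD); [apply: IH; lia | exact: SpZ].
have -> : varpi R i = varpi R (right_nb (val T) i) + ray_v R T i.
  by rewrite /ray_v addrC subrK.
by apply: (SpD) => //; apply: IH; lia.
Qed.

Lemma normal_fan_psi : normal_fan P = @fan_of R n T.
Proof.
rewrite (normal_fan_cube (p := fun S => perm_point R (vertex S)) P_sum_zero _
  vertex_ray_ge0 vertex_ray_gt0 vertex_ray_span) //.
by move=> S; apply: P_perm_point; exact: vertex_in_interval.
Qed.

End Main.

Theorem theorem7p4 (R : realType) (n : nat) (hn : (0 < n)%N) (u : 'S_n) :
  normal_fan
    (@bruhat_polytope R n (perm_h u) (perm_comp (perm_h u) (s1n n))) =
  @fan_of R n (psi u).
Proof. exact: normal_fan_psi. Qed.
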